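(* Fix $p\in(0,1)$ and a real number $c$ with $|c|<2\sqrt{p(1-p)}$. For $N=1,2,\dots$ let $\{x_1,\dots,x_N\}$ be the random $N$-point configuration of the $N$-particle Krawtchouk ensemble on $\{0,1,\dots,2N-1\}$ with parameter $p$. Let $(a_N)$ be an arbitrary sequence of integers with $a_N\sim cN$ (i.e. $a_N/N\to c$) as $N\to\infty$, and consider the shifted random configuration $\{x_1',\dots,x_N'\}\subset\mathbb{Z}$ given by $$x_i'=x_i-N-a_N,\qquad 1\le i\le N .$$ Then, as $N\to\infty$, the random configuration $\{x_1',\dots,x_N'\}$ converges to the translation invariant determinantal random point process on $\mathbb{Z}$ with the correlation kernel $$K_\varphi(x,y)=\frac{\sin(\varphi(x-y))}{\pi(x-y)},\qquad x,y\in\mathbb{Z},$$ where $$\varphi=\arccos\left(\frac{c(1-2p)}{2\sqrt{(1-c^2)p(1-p)}}\right).$$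
   Context: The $N$-particle Krawtchouk ensemble with parameter $p\in(0,1)$: set $L=2N-1$ and $W_{p,L}(x)=\binom{L}{x}p^x(1-p)^{L-x}$ for $x=0,1,\dots,L$. It is the random $N$-point subset $\{x_1,\dots,x_N\}\subset\{0,1,\dots,L\}$ with $$\operatorname{Prob}(\{x_1,\dots,x_N\})=\mathrm{const}(p,N)\cdot\prod_{i=1}^N W_{p,L}(x_i)\prod_{1\le i<j\le N}(x_i-x_j)^2,$$ where $\mathrm{const}(p,N)$ is the normalizing constant. A random point process in a discrete set $\mathfrak X$ is a probability measure on $\operatorname{Conf}(\mathfrak X)=2^{\mathfrak X}$, the compact space of all subsets of $\mathfrak X$ (product topology). It is determinantal with correlation kernel $K$ if for every $n\ge1$ and pairwise distinct $y_1,\dots,y_n\in\mathfrak X$ the probability that the random configuration contains $\{y_1,\dots,y_n\}$ equals $\det[K(y_i,y_j)]_{i,j=1}^n$. Convergence of point processes means weak convergence of the corresponding probability measures on $\operatorname{Conf}(\mathfrak X)$ (equivalently, pointwise convergence of all these correlation functions). Here $\mathfrak X=\mathbb{Z}$, and on the diagonal the kernel is $K_\varphi(x,x)=\varphi/\pi$. *)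

(* Defs.v *)
From HB Require Import structures.
From mathcomp Require Import all_boot all_order all_algebra.
From mathcomp Require Import all_classical all_reals all_analysis.

Set Implicit Arguments.
Unset Strict Implicit.
Unset Printing Implicit Defensive.

Import Order.TTheory GRing.Theory Num.Def Num.Theory.
Import numFieldNormedType.Exports.

Local Open Scope classical_set_scope.
Local Open Scope ring_scope.

Definition borel_type (T : ptopologicalType) := g_sigma_algebraType (@open T).

(** [w x = true] means that [x] belongs to the configuration [w]. *)
Definition Conf (X : Type) : Type := prod_topology (fun _ : X => bool).

HB.instance Definition _ (X : Type) := Pointed.on (Conf X).
HB.instance Definition _ (X : Type) := Topological.on (Conf X).

Definition point_process (X : Type) (R : realType) :=
  probability (borel_type (Conf X)) R.

Definition weakly_converges (R : realType) (T : ptopologicalType)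
    (mu : nat -> probability (borel_type T) R)
    (nu : probability (borel_type T) R) :=
  forall f : T -> R, continuous f -> bounded_fun f ->
    (fun n => \int[mu n]_(x in setT) (f x)%:E)%E @ \oo -->
    (\int[nu]_(x in setT) (f x)%:E)%E.

Definition determinantal (X : Type) (R : realType) (P : point_process X R)
    (K : X -> X -> R) :=
  forall (n : nat) (y : 'I_n -> X), (0 < n)%N -> injective y ->
    P [set w : Conf X | forall i, w (y i)] =
    (\det (\matrix_(i < n, j < n) K (y i) (y j)))%:E.

Definition shift_conf (k : int) (w : Conf int) : Conf int := fun x => w (x - k).

Definition translation_invariant (R : realType) (P : point_process int R) :=
  forall (k : int) (B : set (borel_type (Conf int))), measurable B ->
    P (shift_conf k @^-1` B) = P B.

Definition sine_kernel (R : realType) (phi : R) (x y : int) : R :=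
  if x == y then phi / pi
  else sin (phi * (x - y)%:~R) / (pi * (x - y)%:~R).

(** For [N = 0] the truncated value is [L = 0] and the ensemble below is
    concentrated on the empty configuration. *)
Definition krawtchouk_L (N : nat) : nat := (2 * N - 1)%N.

(** [binomial_pmf L p x] is [C(L, x) p^x (1 - p)^(L - x)]. *)
Definition krawtchouk_weight (R : realType) (p : R) (N : nat)
    (A : {set 'I_(krawtchouk_L N).+1}) : R :=
  (\prod_(i in A) binomial_pmf (krawtchouk_L N) p i) *
  \prod_(i in A) \prod_(j in A | (i < j)%N)
    ((i : nat)%:R - (j : nat)%:R) ^+ 2.

Definition krawtchouk_const (R : realType) (p : R) (N : nat) : R :=
  (\sum_(A : {set 'I_(krawtchouk_L N).+1} | #|A| == N)
     krawtchouk_weight p A)^-1.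

Definition krawtchouk_prob (R : realType) (p : R) (N : nat)
    (A : {set 'I_(krawtchouk_L N).+1}) : R :=
  if #|A| == N then krawtchouk_const p N * krawtchouk_weight p A else 0.

Definition shifted_conf (N : nat) (a : int) (A : {set 'I_(krawtchouk_L N).+1}) :
    Conf int :=
  fun z => [exists i in A, z == (i : nat)%:Z - N%:Z - a].

(** The law of the shifted configuration [{x_i - N - a}], as a measure on
    [Conf int].  The body does not use [hp], which only serves the instance
    below: the law is a probability measure when [0 < p < 1]. *)
Definition shifted_krawtchouk (R : realType) (p : R) (hp : 0 < p < 1)
    (N : nat) (a : int) (B : set (borel_type (Conf int))) : \bar R :=
  (\sum_(A : {set 'I_(krawtchouk_L N).+1})
     (krawtchouk_prob p A)%:E * \d_(shifted_conf a A : borel_type (Conf int)) B)%E.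

Lemma krawtchouk_weight_ge0 (R : realType) (p : R) (N : nat)
    (A : {set 'I_(krawtchouk_L N).+1}) :
  0 < p < 1 -> 0 <= krawtchouk_weight p A.
Proof.
move=> /andP[p0 p1]; apply: mulr_ge0.
  by apply: prodr_ge0 => i _; apply: binomial_pmf_ge0; rewrite !ltW.
by apply: prodr_ge0 => i _; apply: prodr_ge0 => j _; exact: sqr_ge0.
Qed.

Lemma krawtchouk_weight_gt0 (R : realType) (p : R) (N : nat)
    (A : {set 'I_(krawtchouk_L N).+1}) :
  0 < p < 1 -> 0 < krawtchouk_weight p A.
Proof.
move=> /andP[p0 p1]; apply: mulr_gt0; apply: prodr_gt0 => i _.
  rewrite /binomial_pmf pmulrn_lgt0; last by rewrite bin_gt0 -ltnS.
  by rewrite mulr_gt0// exprn_gt0// subr_gt0.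
apply: prodr_gt0 => j /andP[_ ij]; rewrite exprn_even_gt0//= subr_eq0.
by rewrite eqr_nat neq_ltn ij.
Qed.

Lemma krawtchouk_total_gt0 (R : realType) (p : R) (N : nat) : 0 < p < 1 ->
  0 < \sum_(A : {set 'I_(krawtchouk_L N).+1} | #|A| == N)
        krawtchouk_weight p A.
Proof.
move=> hp.
pose T := 'I_(krawtchouk_L N).+1.
have NL : (N <= #|T|)%N.
  rewrite card_ord /krawtchouk_L mul2n -addnn subn1.
  by rewrite (leq_trans _ (leqSpred _))// leq_addr.
have [A cA] : exists A : {set T}, #|A| == N.
  have : (0 < #|[set A : {set T} | #|A| == N]%SET|)%N.
    by rewrite card_draws bin_gt0.
  by case/card_gt0P => A; rewrite inE; exists A.
rewrite (bigD1 A)/= ?cA//; apply: ltr_pwDl; first exact: krawtchouk_weight_gt0.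
by apply: sumr_ge0 => B _; exact: krawtchouk_weight_ge0.
Qed.

Lemma krawtchouk_prob_ge0 (R : realType) (p : R) (N : nat)
    (A : {set 'I_(krawtchouk_L N).+1}) :
  0 < p < 1 -> 0 <= krawtchouk_prob p A.
Proof.
move=> hp; rewrite /krawtchouk_prob; case: ifPn => // _.
by rewrite mulr_ge0 ?krawtchouk_weight_ge0// invr_ge0 ltW ?krawtchouk_total_gt0.
Qed.

Lemma krawtchouk_prob_sum1 (R : realType) (p : R) (N : nat) : 0 < p < 1 ->
  \sum_(A : {set 'I_(krawtchouk_L N).+1}) krawtchouk_prob p A = 1.
Proof.
move=> hp; rewrite -big_mkcond/= -mulr_sumr mulVf//.
by rewrite gt_eqF ?krawtchouk_total_gt0.
Qed.

Section shifted_krawtchouk_probability.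
Context (R : realType) (p : R) (hp : 0 < p < 1) (N : nat) (a : int).
Local Notation law := (shifted_krawtchouk hp N a).

Let law0 : law set0 = 0%E.
Proof. by rewrite /shifted_krawtchouk big1// => A _; rewrite measure0 mule0. Qed.

Let law_ge0 B : (0 <= law B)%E.
Proof.
by apply: sume_ge0 => A _; rewrite mule_ge0// lee_fin krawtchouk_prob_ge0.
Qed.

Let law_sigma_additive : semi_sigma_additive law.
Proof.
move=> F mF tF mUF; rewrite [X in X @ \oo --> _](_ : _ = (fun n =>
  \sum_(A : {set 'I_(krawtchouk_L N).+1}) (krawtchouk_prob p A)%:E *
    \sum_(0 <= i < n) \d_(shifted_conf a A : borel_type (Conf int)) (F i))%E).
  apply: cvg_nnesum => [A _|A _].
    apply: nearW => n; rewrite mule_ge0 ?lee_fin ?krawtchouk_prob_ge0//.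
    exact: sume_ge0.
  by apply: cvgeZl => //; exact: measure_semi_sigma_additive.
apply/funext => n; rewrite exchange_big/=; apply: eq_bigr => A _.
by rewrite ge0_sume_distrr.
Qed.

HB.instance Definition _ := isMeasure.Build _ _ _ law
  law0 law_ge0 law_sigma_additive.

Let law_setT : law setT = 1%E.
Proof.
rewrite /shifted_krawtchouk; under eq_bigr do rewrite diracT mule1.
by rewrite sumEFin krawtchouk_prob_sum1.
Qed.

HB.instance Definition _ := @Measure_isProbability.Build _ _ R law law_setT.

End shifted_krawtchouk_probability.

(* Main.v *)
Require Import Defs.
From HB Require Import structures.
From mathcomp Require Import all_boot all_order all_algebra all_fingroup.
From mathcomp Require Import ring lra zify.
From mathcomp Require Import all_classical all_reals all_analysis.
From mathcomp Require Import measurable_realfun.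

(** Put q = 1 - p and L = 2N - 1.  The N-particle ensemble is a projection
    ensemble: the square of the Vandermonde determinant times the weights is,
    up to a constant, the square of the determinant of psi_n(x_i), n < N, where
    psi_0, ..., psi_L are the orthonormal Krawtchouk functions on {0, ..., L}.
    Hence its correlation functions are the minors of the kernel
    K_N(x, y) = sum_(n < N) psi_n(x) psi_n(y) (krawtchouk_correlation), and
    everything reduces to the pointwise limit of K_N near the site N + a_N.

    That limit comes from a difference equation in x, not from asymptotics of
    the polynomials.  The function psi_n is an eigenvector, with eigenvalue n,
    of a symmetric tridiagonal operator D_N on {0, ..., L} (krawfun_eigen), so
    K_N is the spectral projection of D_N / 2N below the level 1/2.  Around
    the site N + a_N the coefficients of D_N / 2N converge to constants
    (diag_cvg, offdiag_cvg), which means that locally D_N / 2N looks like the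
    convolution operator on the integers with symbol
    f(t) = 1/2 + c (1 - 2p) / 2 - sqrt(p q (1 - c^2)) cos t.
    By the three-term relation, the entries of every polynomial P(D_N / 2N)
    converge to the Fourier coefficients of P(f) (spectral_cvg).  The set
    where f < 1/2 is |t| < phi, and the Fourier coefficients of its indicator
    form the sine kernel.

    To pass from polynomials to the indicator of the half-line below 1/2, a
    sequence of polynomials B_k is used that maps [0, 1] to itself, tends to
    this indicator except at 1/2, and satisfies
    |1_(t < 1/2) - B_k(t)| <= 2 B_k(t) (1 - B_k(t)) (smoothstep_iter_error).
    The right-hand side is again a polynomial, so its spectral sums converge
    as well, to the mean of 2 B_k(f) (1 - B_k(f)), which tends to 0 with k
    because f takes the value 1/2 only at t = phi in [0, pi].  This gives
    kernel_cvg.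

    On the probabilistic side, the correlation functions converge, hence by
    inclusion-exclusion so do the probabilities of all cylinders.  The limits
    are the cylinder probabilities of a measure, obtained as the law of a
    sequence of bits read off from a uniform variable by nested intervals
    (limit_process_exists).  Since the space of configurations is compact, a
    continuous function on it is uniformly close to one that depends on
    finitely many sites, so convergence on cylinders is weak convergence
    (weakly_converges_full_on).  Finally the correlation functions determine a
    point process (point_process_unique), so the limit inherits the
    translation invariance of the sine kernel. *)

Set Implicit Arguments.
Unset Strict Implicit.
Unset Printing Implicit Defensive.
Import Order.TTheory GRing.Theory Num.Def Num.Theory.
Import numFieldNormedType.Exports.
Local Open Scope ring_scope.

(** * The Andreief identity and correlations of determinantal ensembles *)

(** Both sides are the determinant of the block matrix [1, -B; C, 1], factored
    by eliminating either of its off-diagonal blocks. *)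
Lemma det_1D_mulmxC (R : comNzRingType) n k (B : 'M[R]_(n, k)) (C : 'M[R]_(k, n)) :
  \det (1%:M + B *m C) = \det (1%:M + C *m B).
Proof.
have E1 : block_mx 1%:M (- B) C 1%:M =
    block_mx 1%:M 0 C 1%:M *m block_mx 1%:M (- B) 0 (1%:M + C *m B).
  by rewrite mulmx_block !mul1mx !mul0mx !mulmx1 !addr0 mulmxN addrCA addNr addr0.
have E2 : block_mx 1%:M (- B) C 1%:M =
    block_mx 1%:M (- B) 0 1%:M *m block_mx (1%:M + B *m C) 0 C 1%:M.
  by rewrite mulmx_block !mul1mx !mul0mx !mulmx1 !add0r mulNmx addrK.
have := E1; rewrite E2 => /(congr1 determinant).
by rewrite !det_mulmx !det_ublock !det_lblock !det1 !mul1r mulr1.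
Qed.

Lemma det_mul_diag_expand (R : comNzRingType) n m (A : 'M[R]_(n, m)) (t : 'rV[R]_m) :
  \det (A *m diag_mx t *m A^T) =
  \sum_(f : {ffun 'I_n -> 'I_m})
    (\prod_i (A i (f i) * t 0 (f i))) * \det (colsub f A).
Proof.
transitivity (\sum_(s : 'S_n) \sum_(f : {ffun 'I_n -> 'I_m})
   (-1) ^+ s * \prod_i (A i (f i) * t 0 (f i) * A (s i) (f i))).
  apply: eq_bigr => s _; rewrite -mulr_sumr; congr (_ * _).
  rewrite -(bigA_distr_bigA (fun i j => A i j * t 0 j * A (s i) j)) /=.
  apply: eq_bigr => i _; rewrite mxE; apply: eq_bigr => j _.
  by rewrite mul_mx_diag !mxE.
rewrite exchange_big; apply: eq_bigr => f _ /=.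
rewrite -det_tr /determinant mulr_sumr; apply: eq_bigr => s _.
rewrite mulrCA -big_split/=; congr (_ * _); apply: eq_bigr => i _.
by rewrite !mxE.
Qed.

(** Andreief's identity: after expanding one of the two determinants, a
    permutation of the points turns each of its n! terms into the expansion of
    the determinant on the right-hand side. *)
Lemma andreief (R : comNzRingType) n m (A : 'M[R]_(n, m)) (t : 'rV[R]_m) :
  \sum_(f : {ffun 'I_n -> 'I_m})
    (\prod_i t 0 (f i)) * \det (colsub f A) ^+ 2 =
  n`!%:R * \det (A *m diag_mx t *m A^T).
Proof.
pose G (f : {ffun 'I_n -> 'I_m}) :=
  (\prod_i t 0 (f i)) * \det (colsub f A).
transitivity (\sum_(s : 'S_n) \sum_(f : {ffun 'I_n -> 'I_m})
   G f * ((-1) ^+ s * \prod_i A i (f (s i)))).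
  rewrite exchange_big; apply: eq_bigr => f _ /=.
  rewrite -mulr_sumr expr2 mulrA; congr (_ * _).
  rewrite -det_tr /determinant.
  rewrite (reindex_inj invg_inj)/=; apply: eq_bigr => s _; rewrite odd_permV.
  congr (_ * _); rewrite (reindex_perm s)/=.
  by apply: eq_bigr => i _; rewrite !mxE permK.
transitivity (\sum_(s : 'S_n) \det (A *m diag_mx t *m A^T)); last first.
  by rewrite sumr_const card_Sn mulr_natl.
apply: eq_bigr => s _; rewrite det_mul_diag_expand.
pose h (f : {ffun 'I_n -> 'I_m}) := [ffun i => f ((s^-1)%g i)].
have hK : cancel h (fun f => [ffun i => f (s i)]).
  by move=> f; apply/ffunP => i; rewrite !ffunE permK.
rewrite (reindex_inj (can_inj hK)) /=; apply: eq_bigr => f _.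
rewrite /G.
have -> : \prod_i t 0 (h f i) = \prod_i t 0 (f i).
  rewrite (reindex_perm s)/=.
  by apply: eq_bigr => i _; rewrite ffunE permK.
have -> : \det (colsub (h f) A) = (-1) ^+ s * \det (colsub f A) :> R.
  rewrite -det_perm mulrC -det_mulmx; congr (\det _).
  rewrite -[s in perm_mx s]invgK -col_permE.
  by apply/matrixP => i j; rewrite !mxE ffunE.
rewrite mulrA big_split/=.
have -> : \prod_i A i (h f (s i)) = \prod_i A i (f i).
  by apply: eq_bigr => i _; rewrite ffunE permK.
set a := \prod_i t 0 _; set b := \prod_i A i _; set d := \det _; set e := _ ^+ _.
have ee : e * e = 1 by rewrite /e -signr_addb addbb.
by rewrite -[RHS]mulr1 -ee; ring.
Qed.

Lemma card_inj_onto n (T : finType) (S : {set T}) : #|S| = n ->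
  #|[set f : {ffun 'I_n -> T} | injectiveb f & f @: [set: 'I_n] == S]| = n`!.
Proof.
move=> cS; have := @card_inj_ffuns_on 'I_n T (mem S).
rewrite card_ord cS ffactnn => <-; apply: eq_card => f; rewrite !inE.
rewrite andbC; apply/andP/andP => -[]; last first.
  move=> fS fi; split=> //; rewrite eqEcard; apply/andP; split.
    by apply/fintype.subsetP => _ /imsetP[i _ ->]; move/ffun_onP: fS; apply.
  by rewrite card_imset ?cardsT ?card_ord ?cS//; exact/injectiveP.
move=> /eqP fS fi; split=> //; apply/ffun_onP => i.
by rewrite -fS imset_f.
Qed.

(** Up to c, the weight w is the squared minor for every labelling f of a
    set; each set of n points has n! labellings, which cancels the factorial
    of Andreief's identity. *)
Lemma ensemble_generating_function (R : numFieldType) n m (A : 'M[R]_(n, m))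
    (w : {set 'I_m} -> R) (c : R) (t : 'rV[R]_m) :
  (forall f : {ffun 'I_n -> 'I_m}, injective f ->
     w (f @: [set: 'I_n]) = c * \det (colsub f A) ^+ 2) ->
  \sum_(S : {set 'I_m} | #|S| == n) w S * \prod_(x in S) t 0 x =
  c * \det (A *m diag_mx t *m A^T).
Proof.
move=> wE; pose G S := w S * \prod_(x in S) t 0 x.
have n0 : n`!%:R != 0 :> R by rewrite pnatr_eq0 -lt0n fact_gt0.
apply: (mulfI n0); rewrite mulrCA -andreief [RHS]mulr_sumr.
rewrite [RHS](bigID (fun f : {ffun 'I_n -> 'I_m} => injectiveb f))/=.
rewrite [X in _ = _ + X]big1 ?addr0; last first.
  move=> f /injectivePn[i [j ij fij]].
  rewrite -det_tr (determinant_alternate ij) ?expr0n ?mulr0//.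
  by move=> k; rewrite !mxE fij.
transitivity (\sum_(f : {ffun 'I_n -> 'I_m} | injectiveb f) G (f @: [set: 'I_n])).
  rewrite (partition_big (fun f : {ffun 'I_n -> 'I_m} => f @: [set: 'I_n])
    (fun S => #|S| == n))/=; last first.
    by move=> f /injectiveP fi; rewrite card_imset// cardsT card_ord.
  rewrite mulr_sumr; apply: eq_bigr => S /eqP cS.
  rewrite -(card_inj_onto cS) [RHS](eq_bigr (fun=> G S)); last first.
    by move=> f /andP[_ /eqP ->].
  by rewrite sumr_const mulr_natl /G; congr (_ *+ _); apply: eq_card => f; rewrite !inE.
apply: eq_bigr => f /injectiveP fi; rewrite /G wE// big_imset/=; last by move=> i j _ _ /fi.
by rewrite -mulrA [_ ^+ 2 * _]mulrC; congr (_ * (_ * _)); apply: eq_bigl => i; rewrite inE.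
Qed.

(** Used to divide by a variable s and then let s vanish, without taking a limit. *)
Lemma horner0_eq_punctured (R : numDomainType) (p q : {poly R}) :
  (forall s, s != 0 -> p.[s] = q.[s]) -> p.[0] = q.[0].
Proof.
move=> pq; apply/eqP; rewrite -subr_eq0 -hornerN -hornerD; apply/eqP.
suff -> : p - q = 0 by rewrite horner0.
apply/eqP; apply: contraT => r0.
have /(max_poly_roots r0) : all (root (p - q)) [seq i.+1%:R | i <- iota 0 (size (p - q))].
  apply/allP => _ /mapP[i _ ->].
  by rewrite /root hornerD hornerN pq ?subrr// pnatr_eq0.
rewrite map_inj_uniq ?iota_uniq; last by move=> i j /eqP; rewrite eqr_nat eqSS => /eqP.
by rewrite size_map size_iota ltnn; apply.
Qed.

Lemma horner_det_addX (R : comNzRingType) k (K : 'M[R]_k) (s : R) :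
  (\det ('X%:M + map_mx polyC K)).[s] = \det (s%:M + K).
Proof.
rewrite -[LHS]/(horner_eval s _) -det_map_mx; congr (\det _).
by apply/matrixP => i j; rewrite !mxE /= /horner_eval hornerD hornerMn hornerX hornerC.
Qed.

(** Give each of the k chosen sites the weight 1 + u in the generating function.
    It becomes the determinant of 1 + u A_Y A_Y^T, where A_Y keeps the chosen
    columns, hence of 1 + u K_Y with K_Y the minor of the kernel.  The
    coefficient of u^k is on one side the probability that all the chosen
    sites are occupied and on the other side det K_Y.  The proof extracts it
    with u = 1 / s after multiplication by s^k: the two sides are then the
    polynomials p and q in s, which are compared at s = 0. *)
Lemma ensemble_correlation (R : numFieldType) n m (A : 'M[R]_(n, m))
    (P : {set 'I_m} -> R) k (y : 'I_k -> 'I_m) :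
  A *m A^T = 1%:M ->
  (forall t : 'rV_m, \sum_(S : {set 'I_m} | #|S| == n) P S * \prod_(x in S) t 0 x =
     \det (A *m diag_mx t *m A^T)) ->
  injective y ->
  \sum_(S : {set 'I_m} | (#|S| == n) && [forall i, y i \in S]) P S =
  \det (\matrix_(i, j) (A^T *m A) (y i) (y j)).
Proof.
move=> AA gf yi.
pose Y := y @: [set: 'I_k].
have cY : #|Y| = k by rewrite card_imset// cardsT card_ord.
pose c (S : {set 'I_m}) := #|S :&: Y|.
have ck S : (c S <= k)%N by rewrite -[X in (_ <= X)%N]cY subset_leq_card// finset.subsetIr.
pose K := \matrix_(i, j) (A^T *m A) (y i) (y j).
pose p : {poly R} := \sum_(S : {set 'I_m} | #|S| == n)
   P S *: ('X ^+ (k - c S) * ('X + 1) ^+ c S).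
pose q : {poly R} := \det ('X%:M + map_mx polyC K).
have -> : \det K = q.[0].
  by rewrite horner_det_addX raddf0 add0r.
have -> : \sum_(S : {set 'I_m} | (#|S| == n) && [forall i, y i \in S]) P S = p.[0].
  rewrite /p horner_sum big_mkcondr/=.
  apply: eq_bigr => S _.
  rewrite hornerZ hornerM !horner_exp !hornerE.
  rewrite ?add0r expr1n ?mulr1 expr0n.
  suff -> : [forall i, y i \in S] = (k - c S == 0)%N by rewrite /= mulr1; case: (_ == _); rewrite ?mulr1 ?mulr0.
  rewrite subn_eq0; apply/forallP/idP => [yS|kc i].
    rewrite -[X in (X <= _)%N]cY subset_leq_card// finset.subsetI subxx andbT.
    by apply/fintype.subsetP => _ /imsetP[i _ ->].
  have /eqP/finset.setIidPr/fintype.subsetP : S :&: Y == Y by rewrite eqEcard finset.subsetIr cY.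
  by apply; rewrite imset_f.
apply: horner0_eq_punctured => s s0.
have -> : q.[s] = \det (s%:M + K).
  exact: horner_det_addX.
pose t : 'rV[R]_m := \row_x (if x \in Y then 1 + s^-1 else 1).
have -> : s%:M + K = s *: (1%:M + (colsub y A)^T *m (s^-1 *: colsub y A)).
  rewrite scalerDr -scalemxAr scalerA mulfV// scale1r scale_scalar_mx mulr1.
  congr (_ + _); apply/matrixP => i j; rewrite !mxE.
  by apply: eq_bigr => x _; rewrite !mxE.
rewrite detZ -det_1D_mulmxC.
have -> : 1%:M + s^-1 *: colsub y A *m (colsub y A)^T = A *m diag_mx t *m A^T.
  rewrite -AA; apply/matrixP => i j; rewrite !mxE.
  under [RHS]eq_bigr do rewrite mul_mx_diag !mxE.
  rewrite [RHS](bigID (mem Y))/= [X in X + _ = _](bigID (mem Y))/=.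
  rewrite addrAC; congr (_ + _).
    have sumY (F : 'I_m -> R) : \sum_(x in Y) F x = \sum_i F (y i).
      by rewrite big_imset/=; [apply: eq_bigl => l; rewrite inE|move=> ? ? _ _ /yi].
    rewrite !sumY -big_split/=.
    apply: eq_bigr => x _; rewrite !mxE imset_f//.
    by move: (s^-1) => v; ring.
  by apply: eq_bigr => x /negPf xY; rewrite !mxE xY mulr1.
rewrite -gf mulr_sumr /p horner_sum; apply: eq_bigr => S _.
rewrite hornerZ hornerM !horner_exp hornerD hornerX hornerC.
rewrite [RHS]mulrCA; congr (_ * _).
have -> : \prod_(x in S) t 0 x = (1 + s^-1) ^+ c S.
  rewrite (big_setID Y)/= [X in _ * X]big1 ?mulr1; last first.
    by move=> x; rewrite !inE mxE => /andP[/negPf->].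
  rewrite (eq_bigr (fun=> 1 + s^-1)) ?prodr_const// => x.
  by rewrite !inE mxE => /andP[_ ->].
rewrite -{2}(subnK (ck S)) exprD -mulrA -exprMn mulrDr mulr1 mulfV//.
Qed.

Local Open Scope classical_set_scope.
Local Open Scope ring_scope.

(** * Krawtchouk polynomials from their generating function *)

Section krawtchouk_polynomials.
Context (R : realType) (p : R) (L : nat).
Let q := 1 - p.

(** For fixed x, the generating function in n of a rescaling of the Krawtchouk
    polynomials for which the polynomial of index n has leading coefficient
    1 / n! in x. *)
Definition kraw_gf (x : nat) : {poly R} :=
  (1 + q%:P * 'X) ^+ x * (1 - p%:P * 'X) ^+ (L - x).

Definition kraw (n x : nat) : R := (kraw_gf x)`_n.

(** With U = 1 + qT and V = 1 - pT one has U - V = T, so each difference in x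
    produces a factor T, and the two terms add up to T times the derivative
    of U^x V^(L - x). *)
Lemma kraw_gf_difference x : (x <= L)%N ->
  (p * (L - x)%:R)%:P * (kraw_gf x - kraw_gf x.+1) +
  (q * x%:R)%:P * (kraw_gf x - kraw_gf x.-1) = 'X * (kraw_gf x)^`().
Proof.
move=> xL; rewrite /kraw_gf derivM !deriv_exp.
set U := 1 + _; set V := 1 - _.
have -> : U^`() = q%:P by rewrite /U derivD derivM !derivC derivX mul0r mulr1 !add0r.
have -> : V^`() = - p%:P by rewrite /V derivB derivM !derivC derivX mul0r mulr1 !add0r.
have UV : U = V + 'X by rewrite /U /V /q polyCB polyC1; ring.
have -> : (p * (L - x)%:R)%:P * (U ^+ x * V ^+ (L - x) - U ^+ x.+1 * V ^+ (L - x.+1)) =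
  - (p%:P * 'X) * U ^+ x * (V ^+ (L - x).-1 *+ (L - x)).
  rewrite subnS; case: (L - x)%N => [|k]; [by rewrite !mulr0n !mulr0 polyC0 !mul0r|].
  by rewrite -pred_Sn polyCM UV [V ^+ k.+1]exprS [_ ^+ x.+1]exprS raddfMn/= polyC1; ring.
have -> : (q * x%:R)%:P * (U ^+ x * V ^+ (L - x) - U ^+ x.-1 * V ^+ (L - x.-1)) =
   q%:P * 'X * (U ^+ x.-1 *+ x) * V ^+ (L - x).
  case: x xL => [|x] xL; [by rewrite !mulr0n !mulr0 polyC0 !mul0r|].
  rewrite -pred_Sn (_ : L - x = (L - x.+1).+1)%N; last by rewrite -subSn.
  move: (L - x.+1)%N => k; rewrite polyCM UV [V ^+ k.+1]exprS [_ ^+ x.+1]exprS raddfMn/= polyC1; ring.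
ring.
Qed.

Lemma kraw_difference n x : (x <= L)%N ->
  p * (L - x)%:R * (kraw n x - kraw n x.+1) +
  q * x%:R * (kraw n x - kraw n x.-1) = n%:R * kraw n x.
Proof.
move=> /kraw_gf_difference /(congr1 (fun P : {poly R} => P`_n)).
rewrite /kraw coefD !coefCM !coefB => ->; rewrite coefXM coef_deriv.
by case: n => [|n]/=; rewrite ?mul0r// mulr_natl.
Qed.

(** The binomial coefficient of x over j, as a polynomial in x. *)
Definition binpoly (j : nat) : {poly R} :=
  j`!%:R^-1 *: \prod_(i < j) ('X - i%:R%:P).

Lemma horner_binpoly j x : (binpoly j).[x%:R] = 'C(x, j)%:R.
Proof.
have j0 : j`!%:R != 0 :> R by rewrite pnatr_eq0 -lt0n fact_gt0.
apply: (mulfI j0); rewrite hornerZ mulVKf// -natrM mulnC bin_ffact horner_prod.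
elim: j {j0} => [|j IHj]; first by rewrite big_ord0.
rewrite big_ord_recr/= IHj ffactnSr natrM hornerXsubC.
have [jx|xj] := leqP j x; first by rewrite natrB.
by rewrite ffact_small// !mul0r.
Qed.

Lemma size_binpoly j : size (binpoly j) = j.+1.
Proof.
rewrite size_scale ?invr_eq0 ?pnatr_eq0 -?lt0n ?fact_gt0//.
by rewrite size_prod_XsubC /index_enum -enumT size_enum_ord.
Qed.

Lemma lead_binpoly j : (binpoly j)`_j = j`!%:R^-1.
Proof.
have -> : (binpoly j)`_j = lead_coef (binpoly j) by rewrite lead_coefE size_binpoly.
by rewrite lead_coefZ (monicP (monic_prod_XsubC _ _ _)) mulr1.
Qed.

(** Since U = V + T, the generating function is the sum over j of
    'C(x, j) T^j V^(L - j), which exhibits the coefficient of T^n as a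
    combination of binomial coefficients of x. *)
Definition krawpoly (n : nat) : {poly R} :=
  \sum_(j < n.+1) ((1 - p%:P * 'X) ^+ (L - j))`_(n - j) *: binpoly j.

Lemma horner_krawpoly n x : (x <= L)%N -> (krawpoly n).[x%:R] = kraw n x.
Proof.
move=> xL; rewrite /krawpoly /kraw /kraw_gf horner_sum.
under eq_bigr do rewrite hornerZ horner_binpoly.
set V := 1 - p%:P * 'X.
have -> : 1 + q%:P * 'X = V + 'X by rewrite /V /q polyCB polyC1; ring.
rewrite exprDn mulr_suml coef_sum.
pose F j := if (j <= n)%N then (V ^+ (L - j))`_(n - j) * 'C(x, j)%:R else 0.
transitivity (\sum_(0 <= j < n.+1 + x.+1) F j).
  rewrite (big_cat_nat (n := n.+1)) ?leq_addr//= [X in _ + X]big1_seq ?addr0.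
    by rewrite big_mkord; apply: eq_bigr => j _; rewrite /F -ltnS ltn_ord.
  by move=> j; rewrite mem_index_iota /F => /andP[_ /andP[nj _]]; rewrite leqNgt nj.
rewrite (big_cat_nat (n := x.+1)) ?leq_addl//= [X in _ + X]big1_seq ?addr0; last first.
  move=> j; rewrite mem_index_iota /F => /andP[_ /andP[nj _]].
  by rewrite bin_small// mulr0 if_same.
rewrite big_mkord; apply: eq_bigr => j _.
have jx : (j <= x)%N by rewrite -ltnS.
have -> : (V ^+ (x - j) * 'X^j *+ 'C(x, j)) * V ^+ (L - x) =
          V ^+ (L - j) * 'X^j *+ 'C(x, j).
  rewrite mulrnAl mulrAC -exprD; congr (_ ^+ _ * _ *+ _).
  by rewrite addnC addnBA// subnK.
by rewrite coefMn coefMXn /F ltnNge; case: leqP => _/=; rewrite ?mul0rn// mulr_natr.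
Qed.

Lemma size_krawpoly n : (size (krawpoly n) <= n.+1)%N.
Proof.
apply: (leq_trans (size_sum _ _ _)); apply/bigmax_leqP => j _.
by rewrite (leq_trans (size_scale_leq _ _))// size_binpoly.
Qed.

Lemma lead_krawpoly n : (krawpoly n)`_n = n`!%:R^-1.
Proof.
rewrite coef_sum big_ord_recr/= big1 ?add0r.
  rewrite coefZ lead_binpoly subnn -horner_coef0 horner_exp !hornerE.
  by rewrite ?mulr0 ?subr0 ?oppr0 ?addr0 expr1n mul1r.
move=> j _; rewrite coefZ [X in _ * X]nth_default ?mulr0//.
by rewrite size_binpoly ltn_ord.
Qed.

(** The first N polynomials are related to the monomials by a triangular matrix
    with nonzero diagonal, hence the Vandermonde determinant appears up to a
    constant that does not depend on the points. *)
Lemma det_kraw N : exists2 C : R, C != 0 &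
  forall x : 'I_N -> nat, (forall i, (x i <= L)%N) ->
  \det (\matrix_(n < N, i < N) kraw n (x i)) =
  C * \prod_(i < N) \prod_(j < N | (i < j)%N) ((x j)%:R - (x i)%:R).
Proof.
pose Cf := \matrix_(n < N, i < N) (krawpoly n)`_i.
exists (\det Cf) => [|x xL].
  rewrite det_trig; last first.
    apply/is_trig_mxP => n i ni; rewrite mxE nth_default//.
    exact: leq_trans (size_krawpoly n) ni.
  apply/prodf_neq0 => n _; rewrite mxE lead_krawpoly.
  by rewrite invr_eq0 pnatr_eq0 -lt0n fact_gt0.
pose a := \row_(i < N) (x i)%:R : 'rV[R]_N.
have := det_Vandermonde a.
rewrite /a; under [in X in _ = X -> _]eq_bigr do under eq_bigr do rewrite !mxE.
move=> <-; rewrite -det_mulmx; congr (\det _).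
apply/matrixP => n i; rewrite !mxE -horner_krawpoly//.
rewrite (horner_coef_wide _ (leq_trans (size_krawpoly n) (ltn_ord n))).
by apply: eq_bigr => j _; rewrite !mxE.
Qed.

End krawtchouk_polynomials.

(** * Orthonormal Krawtchouk functions *)

Section krawtchouk_functions.
Context (R : realType) (p : R) (hp : 0 < p < 1) (L : nat).
Let q := 1 - p.
Let W := binomial_pmf L p.

Let p0 : 0 < p. Proof. by case/andP: hp. Qed.
Let q0 : 0 < q. Proof. by case/andP: hp => _; rewrite subr_gt0. Qed.

Definition kraw_norm (n : nat) : R :=
  Num.sqrt (\sum_(x < L.+1) W x * kraw p L n x ^+ 2).

Definition krawfun (n x : nat) : R :=
  Num.sqrt (W x) * kraw p L n x / kraw_norm n.

(** The off-diagonal coefficient, between x and x + 1, of the difference operator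
    once it has been symmetrized by the square root of the weight. *)
Definition kraw_offdiag (x : nat) : R :=
  Num.sqrt (p * q * x.+1%:R * (L - x)%:R).

Let W_ge0 x : 0 <= W x.
Proof. by apply: binomial_pmf_ge0; rewrite !ltW//; case/andP: hp. Qed.

(** Detailed balance: this is what makes the difference operator symmetric with
    respect to the binomial weight. *)
Lemma binomial_pmf_balance x :
  W x * (p * (L - x)%:R) = W x.+1 * (q * x.+1%:R).
Proof.
rewrite /W /binomial_pmf /unstable.onem -/q.
have [xL|Lx] := ltnP x L; last first.
  by rewrite (eqP (_ : L - x == 0)%N) ?subn_eq0// [in RHS]bin_small// !(mulr0n, mulr0, mul0r).
rewrite -[(L - x)%N]prednK ?subn_gt0// -subnS !exprS.
rewrite -[p ^+ x * _ *+ _]mulr_natr -[p * p ^+ x * _ *+ _]mulr_natr.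
have /(congr1 (fun k : nat => k%:R : R)) := mul_bin_left L x.
rewrite !natrM -[(L - x)%N]prednK ?subn_gt0// -subnS => E.
transitivity (p ^+ x * p * (q * q ^+ (L - x.+1)) * (((L - x.+1).+1)%:R * 'C(L, x)%:R)).
  ring.
rewrite -E; ring.
Qed.


Lemma kraw_offdiagE x :
  kraw_offdiag x = Num.sqrt (p * (L - x)%:R * (q * x.+1%:R)).
Proof. by rewrite /kraw_offdiag; congr Num.sqrt; ring. Qed.

Lemma sqrt_balance_up x : Num.sqrt (W x) * (p * (L - x)%:R) =
  Num.sqrt (W x.+1) * kraw_offdiag x.
Proof.
have h : 0 <= p * (L - x)%:R by rewrite mulr_ge0// ltW.
rewrite -[in LHS](ger0_norm h) -sqrtr_sqr -sqrtrM// kraw_offdiagE -sqrtrM//.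
by congr Num.sqrt; rewrite expr2 mulrA binomial_pmf_balance mulrAC -mulrA.
Qed.

Lemma sqrt_balance_down x : Num.sqrt (W x.+1) * (q * x.+1%:R) =
  Num.sqrt (W x) * kraw_offdiag x.
Proof.
have h : 0 <= q * x.+1%:R by rewrite mulr_ge0// ltW.
rewrite -[in LHS](ger0_norm h) -sqrtr_sqr -sqrtrM// kraw_offdiagE -sqrtrM//.
by congr Num.sqrt; rewrite expr2 mulrA -binomial_pmf_balance; ring.
Qed.

(** The shift to the left, with value 0 at the boundary. *)
Definition below (f : nat -> R) (x : nat) : R := if x is y.+1 then f y else 0.

(** The difference equation conjugated by the square root of the weight: a
    symmetric three-term relation in x with eigenvalue n. *)
Lemma krawfun_eigen n x : (x <= L)%N ->
  n%:R * krawfun n x = (p * (L - x)%:R + q * x%:R) * krawfun n x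
    - kraw_offdiag x * krawfun n x.+1
    - below (fun y => kraw_offdiag y * krawfun n y) x.
Proof.
move=> xL; have := kraw_difference p n xL.
rewrite /krawfun; set v := (kraw_norm n)^-1 => /(congr1 (fun z => Num.sqrt (W x) * z * v)).
have U := sqrt_balance_up x.
rewrite mulrDr [X in X + _](_ : _ = (Num.sqrt (W x) * (p * (L - x)%:R)) *
  kraw p L n x - Num.sqrt (W x.+1) * kraw_offdiag x * kraw p L n x.+1); last first.
  by rewrite -U; ring.
move=> E; rewrite [LHS](_ : _ = Num.sqrt (W x) * (n%:R * kraw p L n x) * v); last by ring.
rewrite -E; case: x xL U E => [|x] xL U E /=; first by rewrite !(mulr0, mul0r); ring.
have D := sqrt_balance_down x.
rewrite -/q (_ : Num.sqrt (W x.+1) * (q * x.+1%:R * (kraw p L n x.+1 - kraw p L n x)) =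
  Num.sqrt (W x.+1) * (q * x.+1%:R) * kraw p L n x.+1
  - Num.sqrt (W x) * kraw_offdiag x * kraw p L n x); last by rewrite -D; ring.
ring.
Qed.

Lemma kraw0_neq0 n : (n <= L)%N -> kraw p L n 0 != 0.
Proof.
move=> nL; rewrite /kraw /kraw_gf expr0 mul1r subn0.
have -> : 1 - p%:P * 'X = - p *: 'X + 1%:P :> {poly R}.
  by rewrite polyC1 addrC scaleNr mul_polyC.
rewrite polyC1 exprD1n coef_sum (bigD1 (Ordinal (nL : n < L.+1)%N))//= big1 ?addr0; last first.
  by move=> i /eqP ni; rewrite coefMn exprZn coefZ coefXn; case: eqP => [E|]; rewrite ?mulr0 ?mul0rn//;
     case: ni; apply/val_inj.
rewrite coefMn exprZn coefZ coefXn eqxx mulr1 -mulr_natr mulf_neq0//.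
  by rewrite expf_neq0// oppr_eq0 gt_eqF.
by rewrite pnatr_eq0 -lt0n bin_gt0.
Qed.

Lemma kraw_norm_gt0 n : (n <= L)%N -> 0 < kraw_norm n.
Proof.
move=> nL; rewrite sqrtr_gt0 big_ord_recl ltr_pwDl//.
  rewrite pmulr_rgt0 ?exprn_even_gt0//= ?kraw0_neq0//.
  by rewrite /W /binomial_pmf bin0 mulr1n expr0 mul1r exprn_gt0.
by apply: sumr_ge0 => i _; rewrite mulr_ge0// sqr_ge0.
Qed.

(** Eigenvectors of a symmetric operator for distinct eigenvalues are
    orthogonal: (n - m) times the scalar product is a telescoping sum whose
    boundary terms vanish. *)
Lemma krawfun_orthonormal n m : (n <= L)%N -> (m <= L)%N ->
  \sum_(x < L.+1) krawfun n x * krawfun m x = (n == m)%:R.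
Proof.
move=> nL mL; have [<-|nm] := eqVneq n m.
  rewrite /krawfun; under eq_bigr do rewrite mulf_div -!expr2 exprMn sqr_sqrtr//.
  rewrite -mulr_suml -[X in X / _]sqr_sqrtr; last first.
    by apply: sumr_ge0 => i _; rewrite mulr_ge0// sqr_ge0.
  by rewrite divff// expf_neq0// gt_eqF// kraw_norm_gt0.
apply/eqP; rewrite -(mulrI_eq0 _ (_ : GRing.lreg (n%:R - m%:R : R))); last first.
  by apply/lregP; rewrite subr_eq0 eqr_nat.
pose T := below (fun x => kraw_offdiag x *
  (krawfun n x.+1 * krawfun m x - krawfun n x * krawfun m x.+1)).
rewrite mulr_sumr.
rewrite (eq_bigr (fun x : 'I_L.+1 => - (T x.+1 - T x))).
  rewrite sumrN -(big_mkord xpredT (fun x => T x.+1 - T x)) telescope_sumr//=.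
  by rewrite /kraw_offdiag subnn mulr0 sqrtr0 mul0r subr0 oppr0.
move=> [x /= xL] _; rewrite /T.
have En := krawfun_eigen n xL; have Em := krawfun_eigen m xL.
rewrite /= [LHS](_ : _ = (n%:R * krawfun n x) * krawfun m x
  - krawfun n x * (m%:R * krawfun m x)); last by ring.
by rewrite En Em; case: x {xL En Em} => [|x] /=; ring.
Qed.

Definition krawmx : 'M[R]_L.+1 := \matrix_(n, x) krawfun n x.

Lemma krawmx_tr : krawmx *m krawmx^T = 1%:M.
Proof.
apply/matrixP => n m; rewrite !mxE.
under eq_bigr do rewrite !mxE.
by rewrite krawfun_orthonormal// -ltnS.
Qed.

(** A square matrix with orthonormal rows has orthonormal columns. *)
Lemma krawfun_complete x y : (x <= L)%N -> (y <= L)%N ->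
  \sum_(n < L.+1) krawfun n x * krawfun n y = (x == y)%:R.
Proof.
move=> xL yL; have /matrixP/(_ (Ordinal (xL : x < L.+1)%N) (Ordinal (yL : y < L.+1)%N)) :=
  mulmx1C krawmx_tr.
by rewrite !mxE/= => <-; apply: eq_bigr => n _; rewrite !mxE.
Qed.

End krawtchouk_functions.

(** * The Krawtchouk ensemble is determinantal *)

(** The right-hand side does not refer to the order of the points, so it can be
    transported along any labelling of A. *)
Lemma prod_sqr_ordered_pairs (R : realDomainType) m (A : {set 'I_m}) (a : 'I_m -> R) :
  \prod_(i in A) \prod_(j in A | (i < j)%N) (a i - a j) ^+ 2 =
  \prod_(i in A) \prod_(j in A | j != i) `|a i - a j|.
Proof.
transitivity ((\prod_(i in A) \prod_(j in A | (i < j)%N) `|a i - a j|) *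
              (\prod_(i in A) \prod_(j in A | (j < i)%N) `|a i - a j|)).
  rewrite [X in _ = _ * X](exchange_big_dep (mem A))/=; last by move=> i j _ /andP[].
  rewrite -big_split/=; apply: eq_bigr => i iA.
  rewrite [X in _ = _ * X](eq_bigl (fun j : 'I_m => (j \in A) && (i < j)%N)).
    rewrite -big_split/=; apply: eq_bigr => j _.
    by rewrite [`|a j - _|]distrC -expr2 real_normK// num_real.
  by move=> j; rewrite iA.
rewrite -big_split/=; apply: eq_bigr => i _.
rewrite [RHS](bigID (fun j : 'I_m => (i < j)%N))/=; congr (_ * _); apply: eq_bigl => j.
  by case: (ltngtP i j) => [ij|//|/val_inj->]; rewrite ?eqxx ?andbF// -?val_eqE ?(gtn_eqF ij) ?andbT.
by case: (ltngtP i j) => [//|ij|/val_inj->]; rewrite ?eqxx ?andbF// -?val_eqE ?(ltn_eqF ij) ?andbT.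
Qed.

Section krawtchouk_ensemble.
Context (R : realType) (p : R) (hp : 0 < p < 1) (N : nat) (N0 : (0 < N)%N).
Let L := krawtchouk_L N.
Let NL : (N <= L.+1)%N.
Proof. by rewrite /L /krawtchouk_L; lia. Qed.

Definition kraw_kernel (x y : nat) : R :=
  \sum_(n < N) krawfun p L n x * krawfun p L n y.

Let psi_mx : 'M[R]_(N, L.+1) := \matrix_(n, x) krawfun p L n x.

Let psi_mx_tr : psi_mx *m psi_mx^T = 1%:M.
Proof.
apply/matrixP => n m; rewrite !mxE; under eq_bigr do rewrite !mxE.
by rewrite krawfun_orthonormal// -ltnS (leq_trans _ NL).
Qed.

(** The square root of the weight and the norms are diagonal factors; what remains
    is the determinant evaluated by det_kraw, so c depends only on N and p. *)
Lemma krawtchouk_weight_det : exists c : R,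
  forall f : {ffun 'I_N -> 'I_L.+1}, injective f ->
  krawtchouk_weight p (f @: [set: 'I_N]%SET) = c * \det (colsub f psi_mx) ^+ 2.
Proof.
have [C C0 detC] := det_kraw p L N.
pose h := \prod_(n < N) kraw_norm p L n.
have h0 : h != 0.
  by apply/prodf_neq0 => n _; rewrite gt_eqF// kraw_norm_gt0// -ltnS (leq_trans _ NL).
(* h undoes the normalization of the rows, C comes from det_kraw *)
exists (h ^+ 2 / C ^+ 2) => f fi.
have -> : \det (colsub f psi_mx) =
    h^-1 * (\prod_i Num.sqrt (binomial_pmf L p (f i))) *
    (C * \prod_(i < N) \prod_(j < N | (i < j)%N) ((f j)%:R - (f i)%:R)).
  rewrite -(detC (fun i => f i)) => [|i]; last by rewrite -ltnS.
  have -> : colsub f psi_mx = diag_mx (\row_n (kraw_norm p L n)^-1) *m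
     (\matrix_(n < N, i < N) kraw p L n (f i)) *m
     diag_mx (\row_i Num.sqrt (binomial_pmf L p (f i))).
    rewrite mul_mx_diag mul_diag_mx; apply/matrixP => n i; rewrite !mxE /krawfun.
    by rewrite mulrC mulrA mulrAC.
  rewrite !det_mulmx !det_diag mulrAC; congr (_ * _ * _).
    by rewrite /h -prodfV; apply: eq_bigr => n _; rewrite mxE.
  by apply: eq_bigr => n _; rewrite mxE.
rewrite !exprMn exprVn.
have -> : (\prod_i Num.sqrt (binomial_pmf L p (f i))) ^+ 2 = \prod_i binomial_pmf L p (f i).
  rewrite -prodrXl; apply: eq_bigr => i _; rewrite sqr_sqrtr// binomial_pmf_ge0//.
  by case/andP: hp => /ltW-> /ltW->.
have -> : (\prod_(i < N) \prod_(j < N | (i < j)%N) ((f j)%:R - (f i)%:R)) ^+ 2 =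
  \prod_(i < N) \prod_(j < N | (i < j)%N) ((f j)%:R - (f i)%:R) ^+ 2 :> R.
  by rewrite -prodrXl; apply: eq_bigr => i _; rewrite prodrXl.
rewrite /krawtchouk_weight prod_sqr_ordered_pairs.
rewrite !(big_imset _ (in2W fi))/=.
rewrite (eq_bigl xpredT); last by move=> i; rewrite inE.
rewrite [X in _ * X](eq_bigl xpredT); last by move=> i; rewrite inE.
have -> : \prod_(i < N) \prod_(j in f @: [set: 'I_N]%SET | j != f i)
     `|(f i)%:R - (nat_of_ord j)%:R| =
   \prod_(i < N) \prod_(j < N | (i < j)%N) ((f j)%:R - (f i)%:R) ^+ 2 :> R.
  transitivity (\prod_(i in [set: 'I_N]%SET) \prod_(j in [set: 'I_N]%SET | (i < j)%N)
     ((f i)%:R - (f j)%:R) ^+ 2 : R).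
    rewrite (prod_sqr_ordered_pairs _ (fun i => (f i)%:R)).
    apply: eq_big => [i|i _]; first by rewrite inE.
    rewrite big_imset_cond/=; last exact: in2W.
    by apply: eq_bigl => j; rewrite inj_eq.
  apply: eq_big => [i|i _]; first by rewrite inE.
  by apply: eq_big => [j|j _]; rewrite ?inE// -sqrrN opprB.
set a := \prod_i _; set b := \prod_i _.
by field; rewrite h0.
Qed.

Lemma krawtchouk_correlation k (y : 'I_k -> 'I_L.+1) : injective y ->
  \sum_(A : {set 'I_L.+1} | [forall i, y i \in A]) krawtchouk_prob p A =
  \det (\matrix_(i, j) kraw_kernel (y i) (y j)).
Proof.
move=> yi; have [c wE] := krawtchouk_weight_det.
have gf t := ensemble_generating_function t wE.
have cE : krawtchouk_const p N = c^-1.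
  rewrite /krawtchouk_const; congr _^-1.
  have := gf (const_mx 1); rewrite diag_const_mx mulmx1 psi_mx_tr det1 mulr1 => <-.
  by apply: eq_bigr => A _; rewrite big1 ?mulr1// => i _; rewrite mxE.
have c0 : c != 0.
  have := krawtchouk_total_gt0 N hp.
  by rewrite -invr_gt0 -/(krawtchouk_const p N) cE invr_gt0 => /gt_eqF->.
have corr := @ensemble_correlation R _ _ psi_mx
  (fun A => krawtchouk_const p N * krawtchouk_weight p A) _ y psi_mx_tr _ yi.
transitivity (\det (\matrix_(i < k, j < k) (psi_mx^T *m psi_mx) (y i) (y j))).
  rewrite -corr.
    rewrite [RHS]big_mkcond [LHS]big_mkcond; apply: eq_bigr => A _ /=.
    by rewrite /krawtchouk_prob; case: (#|A| == N) => //=; case: ifP.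
  move=> t; under eq_bigr do rewrite -mulrA.
  by rewrite -mulr_sumr gf cE mulKf.
congr (\det _); apply/matrixP => i j; rewrite !mxE.
by apply: eq_bigr => n _; rewrite !mxE.
Qed.

End krawtchouk_ensemble.

(** * Polynomials approximating a step function *)

Section smoothstep.
Context (R : realType).

(** Attracts [0, 1/2) to 0 and (1/2, 1] to 1, with 1/2 as a repelling fixed point;
    its iterates are polynomials converging to a step function. *)
Definition smoothstep (x : R) : R := 3 * x ^+ 2 - 2 * x ^+ 3.

Lemma smoothstepC x : smoothstep (1 - x) = 1 - smoothstep x.
Proof. by rewrite /smoothstep; ring. Qed.

Lemma smoothstep_lower x : 0 <= x <= 1/2 -> 0 <= smoothstep x <= 1/2.
Proof.
move=> /andP[x0 x1]; apply/andP; split.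
  rewrite (_ : smoothstep x = x ^+ 2 * (3 - 2 * x)); last by rewrite /smoothstep; ring.
  by rewrite mulr_ge0 ?sqr_ge0//; lra.
rewrite -subr_ge0.
rewrite (_ : _ - _ = (1/2 - x) * (1 + x * (2 - 2 * x))); last by rewrite /smoothstep; field.
by rewrite mulr_ge0//; [lra|rewrite addr_ge0// mulr_ge0//; lra].
Qed.

Lemma smoothstep_iter_lower k x : 0 <= x <= 1/2 ->
  0 <= iter k smoothstep x <= 1/2.
Proof. by move=> x01; elim: k => //= k IHk; exact: smoothstep_lower. Qed.

Lemma smoothstep_iterC k x : iter k smoothstep (1 - x) = 1 - iter k smoothstep x.
Proof. by elim: k => //= k ->; rewrite smoothstepC. Qed.

Lemma smoothstep_iter_bound k x : 0 <= x <= 1 -> 0 <= iter k smoothstep x <= 1.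
Proof.
move=> /andP[x0 x1]; have [xh|hx] := leP x (1/2).
  have := @smoothstep_iter_lower k x; rewrite x0 xh => /(_ isT) /andP[-> h]/=.
  by rewrite (le_trans h)//; lra.
have := @smoothstep_iter_lower k (1 - x).
rewrite smoothstep_iterC => /(_ _)/andP[]; first by apply/andP; split; lra.
by move=> a b; apply/andP; split; lra.
Qed.

(** The iterates never cross the level 1/2.  So the one of the numbers y and
    1 - y that measures the distance to the step is at most 1/2, and the other
    one is at least 1/2.  This bounds the error by a polynomial expression in y. *)
Lemma smoothstep_iter_error k x : 0 <= x <= 1 ->
  `|(1/2 < x)%R%:R - iter k smoothstep x| <=
  2 * (iter k smoothstep x * (1 - iter k smoothstep x)).
Proof.
move=> /andP[x0 x1]; have [hx|xh] := ltrP (1/2) x.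
  have := @smoothstep_iter_lower k (1 - x).
  rewrite smoothstep_iterC => /(_ _)/andP[]; first by apply/andP; split; lra.
  move: (iter k smoothstep x) => y a b; rewrite mulr1n ger0_norm//.
  by rewrite -subr_ge0 (_ : _ - _ = (1 - y) * (2 * y - 1)) ?mulr_ge0//; [lra|ring].
have := @smoothstep_iter_lower k x; rewrite x0 xh => /(_ isT) /andP[a b].
move: (iter k smoothstep x) a b => y a b; rewrite mulr0n sub0r normrN ger0_norm//.
by rewrite -subr_ge0 (_ : _ - _ = y * (1 - 2 * y)) ?mulr_ge0//; [lra|ring].
Qed.

(** Below x the map contracts towards 0 by the factor x (3 - 2x), which is less
    than 1 when x < 1/2. *)
Lemma smoothstep_iter_cvg0 x : 0 <= x < 1/2 ->
  (fun k => iter k smoothstep x) @ \oo --> (0 : R).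
Proof.
move=> /andP[x0 xh]; pose r := x * (3 - 2 * x).
have r01 : 0 <= r < 1 by rewrite /r; apply/andP; split; nra.
have bnd k : 0 <= iter k smoothstep x <= x * r ^+ k.
  elim: k => [|k /andP[i0 ik]] /=; first by rewrite expr0 mulr1 x0 lexx.
  move: (iter k smoothstep x) i0 ik => y y0 yr.
  have yx : y <= x.
    case/andP: r01 => r0 r1; apply: (le_trans yr).
    by rewrite ler_piMr// exprn_ile1// ltW.
  rewrite (_ : x * r ^+ k.+1 = r * (x * r ^+ k)); last by rewrite exprS; ring.
  apply/andP; split; first by rewrite /smoothstep; nra.
  apply: le_trans (_ : r * y <= _); last by case/andP: r01 => r0 _; rewrite ler_wpM2l.
  rewrite (_ : smoothstep y = y * (3 - 2 * y) * y); last by rewrite /smoothstep; ring.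
  by rewrite ler_wpM2r// /r; nra.
apply: (@squeeze_cvgr _ _ _ _ (cst 0) (fun k => x * r ^+ k)).
- exact: nearW.
- exact: cvg_cst.
- rewrite -(mulr0 x); apply: cvgMr; apply: cvg_expr.
  by case/andP: r01 => r0 r1; rewrite ger0_norm.
Qed.

Lemma smoothstep_iter_cvg1 x : 1/2 < x <= 1 ->
  (fun k => iter k smoothstep x) @ \oo --> (1 : R).
Proof.
move=> /andP[hx x1].
rewrite (_ : (fun k => iter k smoothstep x) =
  (fun k => 1 - iter k smoothstep (1 - x))); last first.
  by apply/funext => k; rewrite -smoothstep_iterC subKr.
rewrite -[X in _ --> X]subr0; apply: cvgB; first exact: cvg_cst.
by apply: smoothstep_iter_cvg0; apply/andP; split; lra.
Qed.

(** These approximate the indicator of t < 1/2, hence the initial value 1 - t. *)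
Definition steppoly (k : nat) : {poly R} :=
  iter k (fun B => 3%:P * B ^+ 2 - 2%:P * B ^+ 3) (1 - 'X).

Lemma horner_steppoly k t : (steppoly k).[t] = iter k smoothstep (1 - t).
Proof.
elim: k => [|k IHk] /=; first by rewrite !hornerE.
by rewrite !hornerE !IHk /smoothstep /=; ring.
Qed.

End smoothstep.

(** * Means over half a period *)

Lemma cvgr_sum (R : realType) T (F : set_system T) (FF : Filter F) (I : Type)
    (r : seq I) (P : pred I) (f : I -> T -> R) (l : I -> R) :
  (forall i, P i -> f i x @[x --> F] --> l i) ->
  \sum_(i <- r | P i) f i x @[x --> F] --> \sum_(i <- r | P i) l i.
Proof. by move=> fl; apply: cvg_big => //; exact: add_continuous. Qed.

Lemma cvgr_prod (R : realType) T (F : set_system T) (FF : Filter F) (I : Type)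
    (r : seq I) (P : pred I) (f : I -> T -> R) (l : I -> R) :
  (forall i, P i -> f i x @[x --> F] --> l i) ->
  \prod_(i <- r | P i) f i x @[x --> F] --> \prod_(i <- r | P i) l i.
Proof. by move=> fl; apply: cvg_big => //; exact: mul_continuous. Qed.

Lemma cvg_det (R : realType) T (F : set_system T) (FF : Filter F) k
    (M : T -> 'M[R]_k) (M0 : 'M[R]_k) :
  (forall i j, M x i j @[x --> F] --> M0 i j) ->
  \det (M x) @[x --> F] --> \det M0.
Proof.
move=> MM0; apply: cvgr_sum => s _; apply: cvgM; first exact: cvg_cst.
by apply: cvgr_prod => i _; exact: MM0.
Qed.

Section mean.
Context (R : realType).
Let mu := @lebesgue_measure R.

(** For an even function h of period 2 pi this is the mean over a period; all
    the symbols here are even, and Fourier coefficients are taken against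
    cosines. *)
Definition mean (h : R -> R) : R :=
  pi^-1 * \int[mu]_(t in `[0, pi]) h t.

Lemma continuous_integrable_itv (a b : R) (h : R -> R) : continuous h ->
  mu.-integrable `[a, b] (EFin \o h).
Proof.
move=> ch; apply: continuous_compact_integrable; first exact: segment_compact.
exact: continuous_subspaceT.
Qed.

Lemma meanD (g h : R -> R) : continuous g -> continuous h ->
  mean (fun t => g t + h t) = mean g + mean h.
Proof.
by move=> cg ch; rewrite /mean RintegralD ?mulrDr//; exact: continuous_integrable_itv.
Qed.

Lemma meanZ k (h : R -> R) : continuous h ->
  mean (fun t => k * h t) = k * mean h.
Proof.
move=> ch; rewrite /mean.
have ih : mu.-integrable `[0, pi] (EFin \o h) by exact: continuous_integrable_itv.
by rewrite (@RintegralZl _ _ _ mu `[0, pi] h k _ ih)// mulrCA.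
Qed.

Lemma mean_sum n (h : 'I_n -> R -> R) : (forall i, continuous (h i)) ->
  mean (fun t => \sum_i h i t) = \sum_i mean (h i).
Proof.
elim: n h => [|n IHn] h ch.
  rewrite big_ord0 /mean.
  under eq_Rintegral do rewrite big_ord0.
  by rewrite Rintegral_cst// mul0r mulr0.
rewrite big_ord_recl -IHn// -meanD//; last first.
  by move=> x; apply: cvgr_sum => i _; exact: ch.
by congr mean; apply/funext => t; rewrite big_ord_recl.
Qed.

Lemma integral_cos (a v : R) : 0 <= a -> v != 0 ->
  \int[mu]_(t in `[0, a]) cos (t * v) = sin (a * v) / v.
Proof.
rewrite le_eqVlt => /predU1P[<- v0|a0 v0].
  by rewrite set_itv1 Rintegral_set1 mul0r sin0 mul0r.
have cs : continuous (fun t : R => cos (t * v)).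
  move=> t; apply: (@cvg_comp _ _ _ (fun u : R => u * v) (@cos R) _ (nbhs (t * v))).
    by apply: cvgMr_tmp; exact: cvg_id.
  exact: continuous_cos.
have dF (t : R) : is_derive t 1 (fun t => sin (t * v) / v) (cos (t * v)).
  have -> : (fun t => sin (t * v) / v) = v^-1 \*: ((@sin R) \o (v \*: id)).
    by apply/funext => u; rewrite /= mulrC [u * v]mulrC.
  apply: is_derive_eq.
  by rewrite /GRing.scale/= mulr1 mulrC mulfK// mulrC.
rewrite /Rintegral (@continuous_FTC2 _ _ (fun t => sin (t * v) / v))//.
- by rewrite mul0r sin0 mul0r sube0.
- exact: continuous_subspaceT.
- have cF : continuous (fun t : R => sin (t * v) / v).
    by move=> t; apply/differentiable_continuous/derivable1_diffP; exact: (@ex_derive _ _ _ _ _ _ _ (dF t)).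
  split.
  + by move=> x _; exact: ex_derive.
  + by apply: cvg_at_right_filter; exact: cF.
  + by apply: cvg_at_left_filter; exact: cF.
- by move=> x x01; rewrite derive1E (@derive_val _ _ _ _ _ _ _ (dF x)).
Qed.


Lemma sin_pi_int (j : int) : sin (pi * j%:~R) = 0 :> R.
Proof.
have sn (n : nat) : sin (pi * n%:R) = 0 :> R.
  elim: n => [|n IHn]; first by rewrite mulr0 sin0.
  by rewrite -natr1 mulrDr mulr1 sinDpi IHn oppr0.
case: j => n; first exact: sn.
by rewrite NegzE mulrNz mulrN sinN sn oppr0.
Qed.

Lemma mean_cst1 : mean (fun=> 1) = 1.
Proof.
have mu_pi : mu `[0, pi] = pi%:E.
  by rewrite /mu lebesgue_measure_itv/= lte_fin pi_gt0 sube0.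
by rewrite /mean Rintegral_cst// mul1r [X in fine X](_ : _ = pi%:E)//= mulVf// gt_eqF// pi_gt0.
Qed.

Lemma mean_cos (j : int) : mean (fun t => cos (t * j%:~R)) = (j == 0)%:R.
Proof.
have [->|j0] := eqVneq j 0.
  rewrite (_ : (fun t => _) = fun=> 1) ?mean_cst1//.
  by apply/funext => t; rewrite mulr0 cos0.
by rewrite /mean integral_cos ?intr_eq0// ?pi_ge0// sin_pi_int mul0r mulr0.
Qed.

Lemma continuous_cosM (v : R) : continuous (fun t : R => cos (t * v)).
Proof.
move=> t; apply: (@cvg_comp _ _ _ (fun u : R => u * v) (@cos R) _ (nbhs (t * v))).
  by apply: cvgMr_tmp; exact: cvg_id.
exact: continuous_cos.
Qed.

(** Dominated convergence, with one exceptional point: the step polynomials stay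
    equal to 1/2 at the edge of the step. *)
Lemma mean_cvg (h : nat -> R -> R) (g : R -> R) (phi M : R) :
  (forall k, continuous (h k)) -> measurable_fun `[0, pi] g ->
  (forall k t, t \in `[0, pi] -> `|h k t| <= M) ->
  (forall t, t \in `[0, pi] -> t != phi -> (fun k => h k t) @ \oo --> g t) ->
  (fun k => mean (h k)) @ \oo --> mean g.
Proof.
move=> ch mg hM hg; rewrite /mean; apply: cvgMl_tmp.
have [] := @dominated_convergence _ _ R mu `[0, pi] (measurable_itv _)
  (fun k t => (h k t)%:E) (fun t => (g t)%:E) (fun=> M%:E).
- move=> k; apply/measurable_EFinP; apply: measurable_funS (continuous_measurable_fun (ch k)) => //.
- by apply/measurable_EFinP.
- exists [set phi]; split; [exact: measurable_set1|exact: lebesgue_measure_set1|].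
  move=> t /= H; apply/eqP; apply: contra_notT H => tphi tpi.
  by apply: cvg_EFin; [exact: nearW|exact: hg].
- by apply: continuous_integrable_itv => t; exact: cvg_cst.
- by apply: aeW => t k tpi; rewrite lee_fin; exact: hM.
move=> ig _ H; apply: fine_cvg; rewrite /= fineK//; exact: integrable_fin_num.
Qed.

End mean.

(** * The limit symbol and its half-level set *)

Section symbol.
Context (R : realType) (al be : R).
Hypothesis be0 : 0 < be.
Hypothesis al_be : `|al| < 2 * be.
Hypothesis al_be1 : `|al| / 2 + be <= 1 / 2.

(** With al = c (1 - 2p) and be = sqrt(p q (1 - c^2)), the diagonal coefficient
    1/2 + al / 2 and the off-diagonal coefficients - be / 2 are the limits of
    those of the rescaled difference operator. *)
Definition symbol (t : R) : R := 1/2 + al / 2 - be * cos t.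
Let phi : R := acos (al / (2 * be)).

Let cosphi_bound : -1 < al / (2 * be) < 1.
Proof.
have b0 : 0 < 2 * be by rewrite mulr_gt0.
by move: al_be; rewrite ltr_norml ltr_pdivlMr// ltr_pdivrMr// mulN1r mul1r.
Qed.

Let cosphi_boundW : -1 <= al / (2 * be) <= 1.
Proof. by case/andP: cosphi_bound => /ltW-> /ltW->. Qed.

Lemma symbol_angle_itv : phi \in `[0, pi].
Proof. by rewrite in_itv/= acos_ge0// acos_lepi. Qed.

Lemma continuous_symbol : continuous symbol.
Proof.
move=> t; apply: cvgB; first exact: cvg_cst.
by apply: cvgMl_tmp; exact: continuous_cos.
Qed.

Lemma symbol_bound t : 0 <= symbol t <= 1.
Proof.
have /ler_normlP[c1 c2] := cos_max t.
have /ler_normlP[a1 a2] := lexx `|al|.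
rewrite /symbol; move: be0 al_be1 c1 c2 a1 a2.
move: (cos t) `|al| => u v ? ? ? ? ? ?; apply/andP; split; nra.
Qed.

Lemma symbol_lt_half t : t \in `[0, pi] -> (symbol t < 1/2) = (t < phi).
Proof.
move=> tpi; rewrite -(ltr_cos tpi symbol_angle_itv) acosK ?in_itv//=.
rewrite /symbol ltr_pdivrMr ?mulr_gt0//.
by apply/idP/idP => ?; lra.
Qed.

Lemma symbol_gt_half t : t \in `[0, pi] -> (1/2 < symbol t) = (phi < t).
Proof.
move=> tpi; rewrite -(ltr_cos symbol_angle_itv tpi) acosK ?in_itv//=.
rewrite /symbol ltr_pdivlMr ?mulr_gt0//.
by apply/idP/idP => ?; lra.
Qed.


Let B (k : nat) (t : R) : R := (steppoly R k).[symbol t].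

Lemma continuous_poly_symbol (P : {poly R}) : continuous (fun t => P.[symbol t]).
Proof.
move=> t; apply: (@cvg_comp _ _ _ symbol (horner P) _ (nbhs (symbol t))).
  exact: continuous_symbol.
exact: continuous_horner.
Qed.

Let B01 k t : 0 <= B k t <= 1.
Proof.
rewrite /B horner_steppoly smoothstep_iter_bound//.
by have /andP[? ?] := symbol_bound t; apply/andP; split; lra.
Qed.

Let B_cvg t : t \in `[0, pi] -> t != phi ->
  (fun k => B k t) @ \oo --> ((t < phi)%R%:R : R).
Proof.
move=> tpi tphi; rewrite /B; under eq_fun do rewrite horner_steppoly.
have /andP[s0 s1] := symbol_bound t.
have [tp|pt] := ltrP t phi.
  apply: smoothstep_iter_cvg1; move: tp; rewrite -symbol_lt_half// => tp.
  by apply/andP; split; lra.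
apply: smoothstep_iter_cvg0; have : phi < t by rewrite lt_neqAle pt eq_sym tphi.
by rewrite -symbol_gt_half// => tp; apply/andP; split; lra.
Qed.

Lemma mean_step_error :
  (fun k => mean (fun t => 2 * (B k t * (1 - B k t)))) @ \oo --> (0 : R).
Proof.
have -> : 0 = mean (fun=> 0 : R).
  by rewrite /mean Rintegral_cst// mul0r mulr0.
apply: (@mean_cvg _ _ _ phi 1) => //.
- move=> k; rewrite (_ : (fun t => _) =
      (fun t => (2%:P * (steppoly R k * (1 - steppoly R k))).[symbol t])).
    exact: continuous_poly_symbol.
  by apply/funext => t; rewrite !hornerE.
- move=> k t _; have /andP[b0 b1] := B01 k t.
  rewrite ger0_norm; last by rewrite !mulr_ge0// subr_ge0.
  by move: (B k t) b0 b1 => b b0 b1; nra.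
- move=> t tpi tphi; have := B_cvg tpi tphi.
  set l := _%:R => Bl; rewrite (_ : 0 = 2 * (l * (1 - l))).
    apply: cvgMl_tmp; apply: cvgM => //; apply: cvgB => //; exact: cvg_cst.
  by rewrite /l; case: (t < phi); rewrite ?(subrr, mulr0, mul0r).
Qed.

Lemma mean_step_cos (x y : int) :
  (fun k => mean (fun t => B k t * cos (t * (x - y)%:~R))) @ \oo -->
  sine_kernel phi x y.
Proof.
set j := x - y; pose g := (fun t : R => cos (t * j%:~R)) \_ `[0, phi]%classic.
have /andP[phi0 phipi] : 0 <= phi <= pi by have := symbol_angle_itv; rewrite in_itv.
have -> : sine_kernel phi x y = mean g.
  rewrite /mean -Rintegral_mkcondr (_ : `[0, pi]%classic `&` `[0, phi]%classic = `[0, phi]%classic :> set R); last first.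
    by apply: setIidr; apply: subset_itvl; rewrite bnd_simp.
  rewrite /sine_kernel -/j; case: eqVneq => [xy|xy].
    under eq_Rintegral do rewrite /j xy subrr mulr0 cos0.
    have mphi : lebesgue_measure (`[0, phi]%classic : set R) = phi%:E.
      rewrite lebesgue_measure_itv/= lte_fin sube0; case: ltP => //.
      by move=> p0; congr EFin; apply/eqP; rewrite eq_le phi0 p0.
    by rewrite Rintegral_cst// mul1r [X in fine X](_ : _ = phi%:E)//= mulrC.
  by rewrite integral_cos// ?intr_eq0 ?subr_eq0// invfM mulrCA mulrA.
apply: (@mean_cvg _ _ _ phi 1).
- move=> k t; apply: cvgM; first exact: continuous_poly_symbol.
  exact: continuous_cosM.
- apply: measurable_funTS; apply/measurable_restrict => //.
  apply: measurable_funTS; apply: continuous_measurable_fun; exact: continuous_cosM.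
- move=> k t _; rewrite normrM; have /andP[b0 b1] := B01 k t.
  by rewrite mulr_ile1// ?normr_ge0// ?cos_max// ger0_norm.
- move=> t tpi tphi; rewrite (_ : g t = (t < phi)%R%:R * cos (t * j%:~R)).
    by apply: cvgM; [exact: B_cvg|exact: cvg_cst].
  rewrite /g patchE mem_setE in_itv/= (itvP tpi)/= le_eqVlt (negPf tphi)/=.
  by case: ifP; rewrite ?mul1r ?mul0r.
Qed.

End symbol.

(** * Spectral sums of the difference operator *)

Section spectral_sums.
Context (R : realType) (p : R) (hp : 0 < p < 1).

(** The entries of P(D / 2N), where D is the difference operator diagonalized by
    the Krawtchouk functions. *)
Definition kraw_spectral (N : nat) (P : {poly R}) (x y : nat) : R :=
  \sum_(n < (krawtchouk_L N).+1)
    P.[n%:R / (2 * N)%:R] *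
    (krawfun p (krawtchouk_L N) n x * krawfun p (krawtchouk_L N) n y).

Lemma kraw_spectral1 N x y : (x <= krawtchouk_L N)%N -> (y <= krawtchouk_L N)%N ->
  kraw_spectral N 1 x y = (x == y)%:R.
Proof.
move=> xL yL; rewrite -(krawfun_complete hp xL yL).
by apply: eq_bigr => n _; rewrite hornerC mul1r.
Qed.

Lemma kraw_spectral_coef N P x y :
  kraw_spectral N P x y = \sum_(i < size P) P`_i * kraw_spectral N 'X^i x y.
Proof.
rewrite /kraw_spectral; under [RHS]eq_bigr do rewrite mulr_sumr.
rewrite exchange_big; apply: eq_bigr => n _ /=.
rewrite horner_coef mulr_suml; apply: eq_bigr => i _.
by rewrite hornerXn mulrA.
Qed.

(** Multiplication of the polynomial by the variable is application of the
    difference operator in x. *)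
Lemma kraw_spectralMX N m x y : (x.+1 <= krawtchouk_L N)%N ->
  kraw_spectral N 'X^(m.+1) x.+1 y =
    (p * (krawtchouk_L N - x.+1)%:R + (1 - p) * x.+1%:R) / (2 * N)%:R *
      kraw_spectral N 'X^m x.+1 y
  - kraw_offdiag p (krawtchouk_L N) x.+1 / (2 * N)%:R * kraw_spectral N 'X^m x.+2 y
  - kraw_offdiag p (krawtchouk_L N) x / (2 * N)%:R * kraw_spectral N 'X^m x y.
Proof.
move=> xL; rewrite /kraw_spectral !mulr_sumr -!sumrB; apply: eq_bigr => n _.
rewrite !hornerXn exprS.
have := krawfun_eigen hp n xL => /= E.
set u := (2 * N)%:R^-1; set v := (n%:R / (2 * N)%:R) ^+ m.
rewrite [LHS](_ : _ = v * u * (n%:R * krawfun p (krawtchouk_L N) n x.+1) *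
  krawfun p (krawtchouk_L N) n y); last by rewrite -/u; ring.
by rewrite E; ring.
Qed.

(** The kernel is the spectral sum of the indicator of t < 1/2, because the
    points n / 2N with n < N are those below 1/2.  The off-diagonal error is
    reduced to diagonal entries by 2 |u v| <= u^2 + v^2. *)
Lemma kraw_kernel_approx N k x y : (0 < N)%N ->
  `|kraw_kernel p N x y - kraw_spectral N (steppoly R k) x y| <=
  kraw_spectral N (steppoly R k * (1 - steppoly R k)) x x +
  kraw_spectral N (steppoly R k * (1 - steppoly R k)) y y.
Proof.
move=> N0; set L := krawtchouk_L N; set B := steppoly R k.
have NL : (N <= L.+1)%N by rewrite /L /krawtchouk_L; lia.
have -> : kraw_kernel p N x y =
    \sum_(n < L.+1) ((n < N)%N)%:R * (krawfun p L n x * krawfun p L n y).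
  rewrite /kraw_kernel (big_ord_widen _ (fun n => krawfun p L n x * krawfun p L n y) NL) big_mkcond.
  by apply: eq_bigr => n _; case: ifP; rewrite ?mul1r ?mul0r.
rewrite /kraw_spectral -sumrB -big_split/=.
apply: (le_trans (ler_norm_sum _ _ _)); apply: ler_sum => n _.
rewrite -mulrBl normrM; set t := n%:R / (2 * N)%:R.
have N20 : 0 < (2 * N)%:R :> R by rewrite ltr0n muln_gt0.
have t01 : 0 <= 1 - t <= 1.
  have : 0 <= t by rewrite divr_ge0.
  have : t <= 1.
    rewrite ler_pdivrMr// mul1r ler_nat ltnW// (leq_trans (ltn_ord n))//.
    by rewrite /L /krawtchouk_L; lia.
  by move=> ? ?; apply/andP; split; lra.
have Bt : B.[t] = iter k (@smoothstep R) (1 - t) by exact: horner_steppoly.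
have -> : (n < N)%N = (1/2 < 1 - t).
  rewrite ltrBrDr -ltrBrDl (_ : 1 - 1/2 = 2^-1); last by field.
  rewrite ltr_pdivrMr// natrM mulrA mulVf ?pnatr_eq0// mul1r ltr_nat//.
have := smoothstep_iter_error k t01; rewrite -Bt => err.
apply: (le_trans (ler_wpM2r (normr_ge0 _) err)).
rewrite hornerM hornerD hornerN hornerC -mulrDr.
set e := B.[t] * _.
have e0 : 0 <= e.
  by rewrite /e Bt; have /andP[b0 b1] := smoothstep_iter_bound k t01; rewrite mulr_ge0// subr_ge0.
rewrite [2 * e]mulrC -mulrA ler_wpM2l//.
rewrite normrM -[krawfun p L n x * krawfun p L n x]expr2 -[krawfun p L n y * _]expr2.
rewrite -(real_normK (num_real (krawfun p L n x))) -(real_normK (num_real (krawfun p L n y))).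
move: `|_| `|krawfun p L n y| => u v.
by have := sqr_ge0 (u - v); rewrite sqrrB; lra.
Qed.

End spectral_sums.

(** * Coefficients of the difference operator near a macroscopic point *)

Section parameters.
Context (R : realType) (p c : R).
Hypothesis hp : 0 < p < 1.
Hypothesis hc : `|c| < 2 * Num.sqrt (p * (1 - p)).

(** The hypothesis on c in the form in which it makes the angle phi well defined. *)
Lemma sqr_c_lt : c ^+ 2 < 4 * (p * (1 - p)).
Proof.
have pq0 : 0 <= p * (1 - p) by case/andP: hp => ? ?; rewrite mulr_ge0//; lra.
rewrite -[c ^+ 2]real_normK ?num_real// (_ : 4 * _ = (2 * Num.sqrt (p * (1 - p))) ^+ 2).
  by rewrite ltr_sqr ?nnegrE// mulr_ge0// sqrtr_ge0.
by rewrite exprMn sqr_sqrtr//; ring.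
Qed.

Lemma c_lt1 : -1 < c < 1.
Proof.
have := sqr_c_lt; case/andP: hp => p0 p1 h.
have : c ^+ 2 < 1 by have := sqr_ge0 (1 - 2 * p); lra.
by move=> ?; rewrite -ltr_norml -sqrtr_sqr -[X in _ < X]sqrtr1 ltr_sqrt.
Qed.

Let al := c * (1 - 2 * p).
Let be := Num.sqrt (p * (1 - p) * (1 - c ^+ 2)).

Let c1 : 0 < 1 - c ^+ 2.
Proof. by have /andP[? ?] := c_lt1; nra. Qed.

Let pq0 : 0 < p * (1 - p).
Proof. by case/andP: hp => ? ?; rewrite mulr_gt0//; lra. Qed.

Let be2 : be ^+ 2 = p * (1 - p) * (1 - c ^+ 2).
Proof. by rewrite sqr_sqrtr// mulr_ge0// ltW. Qed.

Lemma offdiag_limit_gt0 : 0 < be.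
Proof. by rewrite sqrtr_gt0 mulr_gt0. Qed.

(** Since (1 - 2p)^2 = 1 - 4 p q, the squared inequality is equivalent to
    c^2 < 4 p q. *)
Lemma diag_limit_lt : `|al| < 2 * be.
Proof.
have b0 := offdiag_limit_gt0.
rewrite -ltr_sqr ?nnegrE// ?mulr_ge0// ?(ltW b0)//.
rewrite real_normK ?num_real// [(2 * be) ^+ 2]exprMn be2 /al.
by have := sqr_c_lt; move: c1 => _ ?; lra.
Qed.

(** With u = |1 - 2p| and v = |c| the claim amounts to
    (1 - u^2) (1 - v^2) <= (1 - u v)^2, that is 0 <= (u - v)^2.  It keeps the
    values of the symbol in [0, 1], where the step polynomials are controlled. *)
Lemma symbol_range : `|al| / 2 + be <= 1 / 2.
Proof.
have b0 := offdiag_limit_gt0; have b2 := be2.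
have al1 : `|al| = `|c| * `|1 - 2 * p| by rewrite /al normrM.
have u2 : `|1 - 2 * p| ^+ 2 = (1 - 2 * p) ^+ 2 by rewrite real_normK ?num_real.
have v2 : `|c| ^+ 2 = c ^+ 2 by rewrite real_normK ?num_real.
have v1 : `|c| < 1 by rewrite ltr_norml c_lt1.
have u1 : `|1 - 2 * p| < 1 by rewrite ltr_norml; case/andP: hp => ? ?; apply/andP; split; lra.
rewrite al1; move: `|c| `|1 - 2 * p| (normr_ge0 c) (normr_ge0 (1 - 2 * p)) u2 v2 v1 u1.
move=> v u v0 u0 u2 v2 v1 u1.
have uv1 : v * u <= 1 by rewrite mulr_ile1// ltW.
suff : 2 * be <= 1 - v * u by move=> ?; lra.
rewrite -ler_sqr ?nnegrE ?mulr_ge0// ?(ltW b0)// ?subr_ge0// exprMn b2 -v2.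
have -> : p * (1 - p) = (1 - u ^+ 2) / 4 by rewrite u2; field.
have := sqr_ge0 (u - v); lra.
Qed.
End parameters.

Section kernel_limit.
Context (R : realType) (c : R).
Hypothesis hc1 : -1 < c < 1.
Context (a : nat -> int).
Hypothesis ha : (fun N : nat => (a N)%:~R / N%:R : R) @ \oo --> c.

Let pos (N : nat) (z : int) : int := N%:Z + a N + z.

(** The site of the original ensemble that is sent to z by the shift; it agrees
    with the integer N + a_N + z once this integer is nonnegative. *)
Definition site (N : nat) (z : int) : nat := `|pos N z|%N.

Let ratio (N : nat) (z : int) : R := (pos N z)%:~R / (2 * N)%:R.

Lemma cvg_invn : (fun n : nat => n%:R^-1 : R) @ \oo --> (0 : R).
Proof.
apply/gtr0_cvgV0; last exact: cvgr_idn.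
by near=> n; rewrite ltr0n; near: n; exact: nbhs_infty_gt.
Unshelve. all: by end_near. Qed.

Let ratio_cvg z : ratio ^~ z @ \oo --> (1 + c) / 2.
Proof.
have -> : (1 + c) / 2 = (1 + c + z%:~R * 0) / 2 by rewrite mulr0 addr0.
have H : (fun N : nat => (1 + (a N)%:~R / N%:R + z%:~R * N%:R^-1) / 2 : R) @ \oo -->
   (1 + c + z%:~R * 0) / 2.
  apply: cvgMr_tmp; apply: cvgD; last by apply: cvgMl_tmp; exact: cvg_invn.
  by apply: cvgD => //; exact: cvg_cst.
apply: cvg_trans H; apply: near_eq_cvg; near=> N.
have N0 : N%:R != 0 :> R.
  by rewrite pnatr_eq0 -lt0n; near: N; exact: nbhs_infty_gt.
rewrite /ratio /pos !intrD natrM -pmulrn.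
by field.
Unshelve. all: by end_near. Qed.

Let pos_itv z : \forall N \near \oo, 0 < pos N z < (2 * N)%:Z - 1.
Proof.
have /andP[c0 c1] := hc1.
near=> N.
have N0 : (0 < N)%N by near: N; exact: nbhs_infty_gt.
have N20 : 0 < (2 * N)%:R :> R by rewrite ltr0n muln_gt0.
apply/andP; split.
  have : 0 < ratio N z.
    by near: N; apply: (cvgr_gt _ (@ratio_cvg z)); lra.
  by rewrite /ratio pmulr_lgt0 ?invr_gt0// ltr0z.
have : ratio N (z + 1) < 1.
  by near: N; apply: (cvgr_lt _ (@ratio_cvg (z + 1))); lra.
rewrite /ratio ltr_pdivrMr// mul1r -[(2 * N)%:R]/((2 * N)%:Z%:~R) ltr_int.
by rewrite /pos; lia.
Unshelve. all: by end_near. Qed.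

Definition interior_site (N : nat) (z : int) : Prop :=
  [/\ site N (z + 1) = (site N z).+1, (0 < site N z)%N,
      (site N z < krawtchouk_L N)%N & (site N z)%:Z = N%:Z + a N + z].

Lemma near_interior_site z : \forall N \near \oo, interior_site N z.
Proof.
near=> N.
have : 0 < pos N z < (2 * N)%:Z - 1 by near: N; exact: pos_itv.
rewrite /interior_site /site /pos /krawtchouk_L => h; split; lia.
Unshelve. all: by end_near. Qed.


Context (p : R).
Hypothesis hp : 0 < p < 1.
Let L := krawtchouk_L.
Let q := 1 - p.

Let rescaled_site (N : nat) (z : int) : Prop :=
  [/\ 0 < (2 * N)%:R :> R,
  (site N z)%:R = ratio N z * (2 * N)%:R,
  (site N z).+1%:R = ratio N (z + 1) * (2 * N)%:R :> R &
  (L N - site N z)%:R = (1 - ratio N (z + 1)) * (2 * N)%:R].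

Let near_rescaled_site z : \forall N \near \oo, rescaled_site N z.
Proof.
near=> N.
have N0 : (0 < N)%N by near: N; exact: nbhs_infty_gt.
have N20 : 0 < (2 * N)%:R :> R by rewrite ltr0n muln_gt0.
have [s1 s2 s3 s4] : interior_site N z by near: N; exact: near_interior_site.
have rE y : ratio N y * (2 * N)%:R = (pos N y)%:~R by rewrite /ratio mulfVK// gt_eqF.
have sE : (pos N z)%:~R = (site N z)%:R :> R by rewrite /pos -s4.
have sE1 : (pos N (z + 1))%:~R = (site N z).+1%:R :> R.
  by rewrite /pos addrA -s4 intrD natr1.
split => //; rewrite ?mulrBl ?rE ?sE ?sE1//.
rewrite mul1r -natrB; first by congr (_%:R); rewrite /L /krawtchouk_L; lia.
by move: s3; rewrite /krawtchouk_L; lia.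
Unshelve. all: by end_near. Qed.

(** The site divided by 2N tends to (1 + c) / 2. *)
Lemma diag_cvg z :
  (fun N => (p * (L N - site N z)%:R + q * (site N z)%:R) / (2 * N)%:R) @ \oo -->
  1/2 + c * (1 - 2 * p) / 2.
Proof.
have H : (fun N => p * (1 - ratio N (z + 1)) + q * ratio N z) @ \oo -->
    p * (1 - (1 + c) / 2) + q * ((1 + c) / 2).
  apply: cvgD; apply: cvgMl_tmp; last exact: ratio_cvg.
  by apply: cvgB; [exact: cvg_cst|exact: ratio_cvg].
have -> : 1/2 + c * (1 - 2 * p) / 2 = p * (1 - (1 + c) / 2) + q * ((1 + c) / 2).
  by rewrite /q; field.
apply: cvg_trans H; apply: near_eq_cvg; near=> N.
have [N20 s1 s2 s3] : rescaled_site N z by near: N; exact: near_rescaled_site.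
by rewrite s1 s3; move: (2 * N)%:R N20 => u u0; field; rewrite gt_eqF.
Unshelve. all: by end_near. Qed.

Lemma offdiag_cvg z :
  (fun N => kraw_offdiag p (L N) (site N z) / (2 * N)%:R) @ \oo -->
  Num.sqrt (p * (1 - p) * (1 - c ^+ 2)) / 2.
Proof.
have /andP[p0 p1] := hp; have /andP[c0 c1] := hc1.
have H : (fun N => Num.sqrt (p * q * (ratio N (z + 1) * (1 - ratio N (z + 1))))) @ \oo -->
    Num.sqrt (p * q * ((1 + c) / 2 * (1 - (1 + c) / 2))).
  apply: (@cvg_comp _ _ _ _ (@Num.sqrt R) _ (nbhs (p * q * ((1 + c) / 2 * (1 - (1 + c) / 2))))).
    apply: cvgMl_tmp; apply: cvgM; first exact: ratio_cvg.
    by apply: cvgB; [exact: cvg_cst|exact: ratio_cvg].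
  exact: sqrt_continuous.
have -> : Num.sqrt (p * (1 - p) * (1 - c ^+ 2)) / 2 =
    Num.sqrt (p * q * ((1 + c) / 2 * (1 - (1 + c) / 2))).
  rewrite (_ : p * q * _ = p * (1 - p) * (1 - c ^+ 2) * 2^-1 ^+ 2); last by rewrite /q; field.
  rewrite [in RHS]sqrtrM; last first.
    by rewrite !mulr_ge0//; [exact: ltW|lra|nra].
  by rewrite sqrtr_sqr ger0_norm// invr_ge0.
apply: cvg_trans H; apply: near_eq_cvg; near=> N.
have [N20 s1 s2 s3] : rescaled_site N z by near: N; exact: near_rescaled_site.
rewrite /kraw_offdiag s2 s3 -/q.
set r := ratio N (z + 1); set u := (2 * N)%:R.
rewrite (_ : p * q * (r * u) * ((1 - r) * u) = u ^+ 2 * (p * q * (r * (1 - r)))); last ring.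
by rewrite [Num.sqrt (u ^+ 2 * _)]sqrtrM ?sqr_ge0// sqrtr_sqr gtr0_norm// [u * _]mulrC mulfK// gt_eqF.
Unshelve. all: by end_near. Qed.

End kernel_limit.

(** * Convergence of the correlation kernels *)

Section kernel_convergence.
Context (R : realType) (p c : R).
Hypothesis hp : 0 < p < 1.
Hypothesis hc : `|c| < 2 * Num.sqrt (p * (1 - p)).
Context (a : nat -> int).
Hypothesis ha : (fun N : nat => (a N)%:~R / N%:R : R) @ \oo --> c.

Let al := c * (1 - 2 * p).
Let be := Num.sqrt (p * (1 - p) * (1 - c ^+ 2)).
Let f := symbol al be.
Let hc1 := c_lt1 hp hc.
Let S (N : nat) (P : {poly R}) (z w : int) :=
  kraw_spectral p N P (site a N z) (site a N w).
Let I (P : {poly R}) (j : int) := mean (fun t => P.[f t] * cos (t * j%:~R)).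

Let cI P (j : int) : continuous (fun t => P.[f t] * cos (t * j%:~R)).
Proof.
move=> t; apply: cvgM; first exact: continuous_poly_symbol.
exact: continuous_cosM.
Qed.

Let I_XM m j : I 'X^(m.+1) j = (1/2 + al / 2) * I 'X^m j
  - be / 2 * I 'X^m (j + 1) - be / 2 * I 'X^m (j - 1).
Proof.
rewrite /I -[- (be / 2 * _)]mulNr -[- (be / 2 * mean _)]mulNr -!meanZ//.
have c1 k j' : continuous (fun t => k * ('X^m.[f t] * cos (t * j'%:~R))).
  by move=> t; apply: cvgMl_tmp; exact: cI.
rewrite -!meanD//; last by move=> t; apply: cvgD; exact: c1.
congr mean; apply/funext => t.
rewrite !hornerXn exprS [in LHS]/f /symbol -/(f t).
rewrite intrD intrB mulrDr mulrBr mulr1 cosD cosB.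
by field.
Qed.

(** Induction on m: the three-term relation for the spectral sums converges to
    the relation obtained from 2 cos t cos (j t) = cos ((j + 1) t) + cos ((j - 1) t). *)
Lemma moment_cvg m z w : (fun N => S N 'X^m z w) @ \oo --> I 'X^m (z - w).
Proof.
elim: m z w => [|m IHm] z w.
  have -> : I 'X^0 (z - w) = (z == w)%:R.
    rewrite /I expr0 (_ : (fun t => _) = fun t => cos (t * (z - w)%:~R)).
      by rewrite mean_cos subr_eq0.
    by apply/funext => t; rewrite hornerC mul1r.
  apply: cvg_near_cst; near=> N.
  have [_ _ z1 z2] : interior_site a N z.
    by near: N; exact: (near_interior_site hc1 ha).
  have [_ _ w1 w2] : interior_site a N w.
    by near: N; exact: (near_interior_site hc1 ha).
  rewrite /S expr0 kraw_spectral1 ?(ltnW z1) ?(ltnW w1)//; congr (_%:R : R).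
  by rewrite -eqz_nat z2 w2 (inj_eq (addrI _)).
have H : (fun N =>
   (p * (krawtchouk_L N - site a N z)%:R + (1 - p) * (site a N z)%:R) / (2 * N)%:R * S N 'X^m z w
   - kraw_offdiag p (krawtchouk_L N) (site a N z) / (2 * N)%:R * S N 'X^m (z + 1) w
   - kraw_offdiag p (krawtchouk_L N) (site a N (z - 1)) / (2 * N)%:R * S N 'X^m (z - 1) w) @ \oo -->
  I 'X^(m.+1) (z - w).
  rewrite I_XM; apply: cvgB; first apply: cvgB.
  - by apply: cvgM; [exact: (diag_cvg hc1 ha)|exact: IHm].
  - apply: cvgM; first exact: (offdiag_cvg hc1 ha hp).
    by rewrite addrAC; exact: IHm.
  - apply: cvgM; first exact: (offdiag_cvg hc1 ha hp).
    by rewrite addrAC; exact: IHm.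
apply: cvg_trans H; apply: near_eq_cvg; near=> N.
have [z1 _ z2 _] : interior_site a N z.
  by near: N; exact: (near_interior_site hc1 ha).
have [] : interior_site a N (z - 1).
  by near: N; exact: (near_interior_site hc1 ha).
rewrite subrK => y1 _ _ _.
by rewrite /S z1 y1 kraw_spectralMX -?y1 ?(ltnW z2).
Unshelve. all: by end_near. Qed.

Lemma spectral_cvg P z w : (fun N => S N P z w) @ \oo --> I P (z - w).
Proof.
have -> : I P (z - w) = \sum_(i < size P) P`_i * I 'X^i (z - w).
  rewrite /I; under eq_bigr do rewrite -meanZ//.
  rewrite -mean_sum; last by move=> i t; apply: cvgMl_tmp; exact: cI.
  congr mean; apply/funext => t; rewrite horner_coef mulr_suml.
  by apply: eq_bigr => i _; rewrite hornerXn mulrA.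
rewrite (_ : (fun N => _) = fun N => \sum_(i < size P) P`_i * S N 'X^i z w); last first.
  by apply/funext => N; rewrite /S kraw_spectral_coef.
by apply: cvgr_sum => i _; apply: cvgMl_tmp; exact: moment_cvg.
Qed.

(** Choose k first, so that B_k(f) is close to the step in mean; then let N grow
    with this k fixed. *)
Lemma kernel_cvg z w :
  (fun N => kraw_kernel p N (site a N z) (site a N w)) @ \oo -->
  sine_kernel (acos (al / (2 * be))) z w.
Proof.
have b0 := offdiag_limit_gt0 hp hc; have ab := diag_limit_lt hp hc.
have ab1 := symbol_range hp hc.
set kap := sine_kernel _ _ _.
apply/cvgrPdist_le => e e0.
(* six errors of this size add up: two on the kernel entry itself, and two on
   each of the diagonal entries that bound the error of the approximation *)
have e4 : 0 < e / 8 by rewrite divr_gt0.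
have /cvgrPdist_le/(_ _ e4) H1 := mean_step_error b0 ab ab1.
have /cvgrPdist_le/(_ _ e4) H2 := @mean_step_cos _ _ _ b0 ab ab1 z w.
have [k [k1 k2]] : exists k,
    `|mean (fun t => 2 * ((steppoly R k).[f t] * (1 - (steppoly R k).[f t])))| <= e / 8 /\
    `|kap - I (steppoly R k) (z - w)| <= e / 8.
  have [k [/= k1 k2]] := filter_ex (filterI H1 H2).
  by exists k; split => //; rewrite -normrN -[- _]sub0r.
have errI v : I (steppoly R k * (1 - steppoly R k)) (v - v) <= e / 8.
  rewrite subrr /I.
  have := k1; rewrite meanZ; last first.
    rewrite (_ : (fun t => _) = fun t => (steppoly R k * (1 - steppoly R k)).[f t]).
      exact: continuous_poly_symbol.
    by apply/funext => t; rewrite !hornerE.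
  rewrite (_ : (fun t => _ * cos _) = (fun t => (steppoly R k).[f t] * (1 - (steppoly R k).[f t]))).
    by move=> /ler_normlP[_]; lra.
  by apply/funext => t; rewrite mulr0 cos0 mulr1 !hornerE.
have /cvgrPdist_le/(_ _ e4) c0 := @spectral_cvg (steppoly R k) z w.
have /cvgrPdist_le/(_ _ e4) c1 := @spectral_cvg (steppoly R k * (1 - steppoly R k)) z z.
have /cvgrPdist_le/(_ _ e4) c2 := @spectral_cvg (steppoly R k * (1 - steppoly R k)) w w.
near=> N.
have N0 : (0 < N)%N by near: N; exact: nbhs_infty_gt.
have /ler_normlP[c01 c02] : `|I (steppoly R k) (z - w) - S N (steppoly R k) z w| <= e / 8.
  by near: N.
have /ler_normlP[c11 c12] : `|I (steppoly R k * (1 - steppoly R k)) (z - z) -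
   S N (steppoly R k * (1 - steppoly R k)) z z| <= e / 8 by near: N.
have /ler_normlP[c21 c22] : `|I (steppoly R k * (1 - steppoly R k)) (w - w) -
   S N (steppoly R k * (1 - steppoly R k)) w w| <= e / 8 by near: N.
have := kraw_kernel_approx hp k (site a N z) (site a N w) N0.
move=> /ler_normlP[d1 d2]; have := errI z; have := errI w.
move/ler_normlP: k2 => [k21 k22].
rewrite /S in c01 c02 c11 c12 c21 c22.
move=> ew ez; apply/ler_normlP; split; lra.
Unshelve. all: by end_near. Qed.

End kernel_convergence.

(** * The compact space of configurations *)

Section configurations.
Context (X : countType).

(** Sites are numbered by their code; the numbers that are not codes are
    declared empty. *)
Definition occupied (i : nat) (w : Conf X) : bool :=
  if unpickle i is Some x then w x else false.

Lemma occupied_pickle x w : occupied (pickle x) w = w x.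
Proof. by rewrite /occupied pickleK. Qed.

Definition bits (n : nat) (w : Conf X) : seq bool := mkseq (fun i => occupied i w) n.

Definition cylinder (v : seq bool) : set (Conf X) := [set w | bits (size v) w = v].

Lemma bits_agree n w w' : bits n w = bits n w' ->
  forall i, (i < n)%N -> occupied i w = occupied i w'.
Proof.
move=> E i iN; have := congr1 (fun s => nth false s i) E.
by rewrite !nth_mkseq.
Qed.

Lemma bits_agree_le m n w w' : (m <= n)%N -> bits n w = bits n w' -> bits m w = bits m w'.
Proof.
move=> mn /bits_agree E; apply/eq_in_map => i; rewrite mem_iota => /andP[_ im].
by rewrite E// (leq_trans im).
Qed.

Lemma bitsS n w : bits n.+1 w = rcons (bits n w) (occupied n w).
Proof. by rewrite /bits mkseqS. Qed.

(** The product topology is the coarsest one that makes the coordinates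
    continuous, so it is enough that the filter of cylinders around w converges
    to w in each coordinate. *)
Lemma nbhs_bits (w : Conf X) (A : set (Conf X)) : nbhs w A ->
  exists n, forall w', bits n w' = bits n w -> A w'.
Proof.
pose F : set_system (Conf X) :=
  filter_from setT (fun n => [set w' | bits n w' = bits n w]).
have FF : Filter F.
  apply: filter_from_filter; first by exists 0%N.
  move=> m n _ _; exists (maxn m n) => // w' /= E; split => /=.
    exact: bits_agree_le (leq_maxl m n) E.
  exact: bits_agree_le (leq_maxr m n) E.
have Fw : F --> w.
  apply/cvg_sup => x U [V] [[W] oW <-] Wwx WU; apply: filterS WU _.
  exists (pickle x).+1 => // w' /= /bits_agree/(_ (pickle x) (ltnSn _)).
  by rewrite !occupied_pickle /proj => ->.
by move=> /Fw[n _ nA]; exists n.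
Qed.

Lemma continuous_coordinate (x : X) : continuous (fun w : Conf X => w x).
Proof. exact: (@proj_continuous X (fun=> bool) x). Qed.

Lemma open_coordinate (x : X) (b : bool) : open [set w : Conf X | w x = b].
Proof.
have /continuousP := @continuous_coordinate x.
by move/(_ [set b] (discrete_open _)).
Qed.

Lemma open_cylinder (v : seq bool) : open (cylinder v).
Proof.
elim/last_ind: v => [|v b IHv].
  by rewrite (_ : cylinder [::] = setT); [exact: openT|apply/seteqP].
rewrite (_ : cylinder _ = cylinder v `&` [set w | occupied (size v) w = b]); last first.
  apply/seteqP; split=> w; rewrite /cylinder/= size_rcons bitsS.
    by move=> /rcons_inj[-> ->].
  by move=> [-> ->].
apply: openI => //; rewrite /occupied; case: unpickle => [x|].
  exact: open_coordinate.
case: b; first by rewrite (_ : mkset _ = set0); [exact: open0|apply/seteqP; split].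
by rewrite (_ : mkset _ = setT); [exact: openT|apply/seteqP; split].
Qed.

Lemma nbhs_bits_eq m (w : Conf X) : nbhs w [set w' | bits m w' = bits m w].
Proof.
have : open_nbhs w (cylinder (bits m w)).
  by split; [exact: open_cylinder|rewrite /cylinder/= size_mkseq].
by move/open_nbhs_nbhs; rewrite /cylinder size_mkseq.
Qed.

Lemma open_bigcup_cylinder (O : set (Conf X)) : open O ->
  O = \bigcup_(v in [set v | cylinder v `<=` O]) cylinder v.
Proof.
move=> oO; apply/seteqP; split => [w Ow|w [v /= vO wv]]; last exact: vO.
have [n nO] := nbhs_bits (open_nbhs_nbhs (conj oO Ow)).
by exists (bits n w); rewrite /cylinder/= size_mkseq//.
Qed.

Lemma compact_conf : compact [set: Conf X].
Proof.
have := @tychonoff X (fun=> bool) (fun=> setT) (fun=> bool_compact).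
by congr compact; apply/seteqP; split.
Qed.

(** Compactness in its near-covering form: agreement up to some rank forces
    closeness near each configuration, hence a common rank works everywhere. *)
Lemma uniform_bits (R : realType) (f : Conf X -> R) (e : R) : continuous f -> 0 < e ->
  exists n, forall w w', bits n w = bits n w' -> `|f w - f w'| < e.
Proof.
move=> cf e0.
have /compact_near_coveringP := compact_conf.
move=> /(_ nat \oo (fun n w => forall w', bits n w = bits n w' -> `|f w - f w'| < e)).
case=> [w _|n _ nP]; last by exists n => w w'; exact: (nP n (leqnn n) w I).
have e2 : 0 < e / 2 by rewrite divr_gt0.
have /cvgrPdist_lt/(_ _ e2) : f x @[x --> w] --> f w by exact: cf.
move=> /nbhs_bits[m mP].
exists ([set w' | bits m w' = bits m w], [set n | (m <= n)%N]) => /=.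
  split; last by exists m.
  exact: nbhs_bits_eq.
move=> [w1 n] /= [E mn] w2 /(bits_agree_le mn) E2.
have := mP w1 E; have := mP w2; rewrite -E2 => /(_ E) /= d2 d1.
rewrite (splitr e) (le_lt_trans (ler_distD (f w) _ _))//.
by rewrite ltrD// distrC.
Qed.

End configurations.

(** * Borel sets of configurations *)

Section borel.
Context (X : countType).
Let T := borel_type (Conf X).

Lemma measurable_open (O : set (Conf X)) : open O -> measurable (O : set T).
Proof. exact: sub_sigma_algebra. Qed.

Lemma measurable_cylinder (v : seq bool) : measurable (cylinder v : set T).
Proof. by apply: measurable_open; exact: open_cylinder. Qed.

(** The probabilities of these events are the correlation functions.  They form
    a class closed under intersection that generates the Borel sets. *)
Definition full_on (F : seq X) : set (Conf X) := [set w | all (fun x => w x) F].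

Lemma full_on_cat F G : full_on F `&` full_on G = full_on (F ++ G).
Proof.
by apply/seteqP; split=> w; rewrite /full_on/= all_cat => /andP.
Qed.

Lemma full_on_nil : full_on [::] = setT.
Proof. by apply/seteqP; split. Qed.

Lemma open_full_on F : open (full_on F).
Proof.
elim: F => [|x F IHF]; first by rewrite full_on_nil; exact: openT.
rewrite (_ : full_on _ = [set w | w x = true] `&` full_on F).
  by apply: openI => //; exact: open_coordinate.
by apply/seteqP; split=> w; rewrite /full_on/= => /andP.
Qed.

Lemma measurable_full_on F : measurable (full_on F : set T).
Proof. by apply: measurable_open; exact: open_full_on. Qed.

(** An open set is a countable union of cylinders. *)
Lemma measurable_preimage_open d (Y : measurableType d) (h : Y -> Conf X) :
  (forall x, measurable [set y | h y x]) ->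
  forall O : set (Conf X), open O -> measurable (h @^-1` O).
Proof.
move=> mh.
have mcyl v : measurable (h @^-1` cylinder v).
  elim/last_ind: v => [|v b IHv].
    by rewrite (_ : _ @^-1` _ = setT)//; apply/seteqP.
  rewrite (_ : _ @^-1` _ = h @^-1` cylinder v `&` [set y | occupied (size v) (h y) = b]); last first.
    apply/seteqP; split=> w; rewrite /cylinder/= size_rcons bitsS.
      by move=> /rcons_inj[-> ->].
    by move=> [-> ->].
  apply: measurableI => //; rewrite /occupied; case: unpickle => [x|].
    case: b; first exact: mh.
    rewrite (_ : mkset _ = ~` [set y | h y x]); first exact/measurableC/mh.
    by apply/seteqP; split=> y /=; case: (h y x).
  case: b; first by rewrite (_ : mkset _ = set0)//; apply/seteqP; split.
  by rewrite (_ : mkset _ = setT)//; apply/seteqP; split.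
move=> O /open_bigcup_cylinder ->; rewrite preimage_bigcup.
rewrite bigcup_mkcond; apply: countable_bigcupT_measurable; first exact: countableP.
by move=> v; case: ifP.
Qed.

Lemma measurable_fun_conf d (Y : measurableType d) (h : Y -> T) :
  (forall x, measurable [set y | (h y : Conf X) x]) -> measurable_fun setT h.
Proof.
move=> mh; apply: (@measurability _ _ _ T setT h (@open (Conf X))) => //.
move=> _ [U openU <-]; rewrite setTI.
exact: (@measurable_preimage_open _ _ (h : Y -> Conf X)).
Qed.

Lemma measurable_fun_continuous (R : realType) (f : Conf X -> R) :
  continuous f -> measurable_fun setT (f : T -> R).
Proof.
move=> /continuousP cf; apply: (measurability _ (RGenOpens.measurableE R)).
move=> _ [_ [a [b ->]] <-]; rewrite setTI; apply: measurable_open; apply: cf.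
exact: interval_open.
Qed.

Lemma borel_full_on : (@measurable _ T) = <<s range full_on >>.
Proof.
apply/seteqP; split.
  apply: smallest_sub; first exact: smallest_sigma_algebra.
  move=> O oO.
  pose U := g_sigma_algebraType (range full_on : set (set (Conf X))).
  apply: (@measurable_preimage_open _ U (fun w : U => (w : Conf X))) => // x.
  apply: sub_sigma_algebra; exists [:: x] => //.
  by apply/seteqP; split=> w /=; rewrite /full_on/= andbT.
apply: smallest_sub; first exact: smallest_sigma_algebra.
by move=> _ [F _ <-]; exact: measurable_full_on.
Qed.

Lemma point_process_unique (R : realType) (P Q : {measure set T -> \bar R}) :
  (P setT < +oo)%E ->
  (forall F, P (full_on F) = Q (full_on F)) ->
  forall B, measurable B -> P B = Q B.
Proof.
move=> PT PQ B mB; apply: (@measure_unique _ R T (range full_on) (fun=> setT) _ _ _ _ P Q) => //.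
- exact: borel_full_on.
- by move=> _ _ [F _ <-] [G _ <-]; exists (F ++ G) => //; rewrite full_on_cat.
- by move=> _; exists [::] => //; exact: full_on_nil.
- by apply/seteqP; split => // w _; exists 0%N.
- by move=> _ [F _ <-]; exact: PQ.
Qed.

End borel.

(** * Cylinder probabilities by inclusion-exclusion *)

(** The finitely many words of length n cut the space into measurable pieces. *)
Lemma measure_word_decomposition d (Y : measurableType d) (R : realType)
    (m : {measure set Y -> \bar R}) (g : Y -> seq bool) n (Q : pred (seq bool)) :
  (forall y, size (g y) = n) ->
  (forall v, measurable (g @^-1` [set v])) ->
  (m [set y | Q (g y)] = \sum_(v : n.-tuple bool | Q v) m (g @^-1` [set tval v]))%E.
Proof.
move=> gn mg.
have mgs (s : seq (seq bool)) : measurable [set y | g y \in s].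
  elim: s => [|v s IHs]; first by rewrite (_ : mkset _ = set0)//; apply/seteqP; split.
  rewrite (_ : mkset _ = g @^-1` [set v] `|` [set y | g y \in s]); first exact: measurableU.
  apply/seteqP; split=> y /=; rewrite inE; first by move=> /orP[/eqP|]; [left|right].
  by move=> [/eqP->//|->]; rewrite orbT.
have ms (s : seq (seq bool)) : uniq s ->
    (m [set y | g y \in s] = \sum_(v <- s) m (g @^-1` [set v]))%E.
  elim: s => [_|v s IHs /= /andP[vs us]].
    by rewrite big_nil (_ : mkset _ = set0) ?measure0//; apply/seteqP; split.
  rewrite big_cons -IHs// -measureU//; last first.
    by apply/seteqP; split => y //= [-> ys]; rewrite ys in vs.
  congr (m _); apply/seteqP; split=> y /=; rewrite inE; first by move=> /orP[/eqP|]; [left|right].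
  by move=> [/eqP->//|->]; rewrite orbT.
rewrite (_ : [set y | Q (g y)] =
    [set y | g y \in map (@tval n bool) (seq.filter (fun v => Q (tval v)) (enum {: n.-tuple bool}))]).
  rewrite ms; last by rewrite (map_inj_uniq val_inj) filter_uniq// enum_uniq.
  by rewrite big_map big_filter enumT.
apply/seteqP; split=> y /=.
  move=> Qg; apply/mapP; exists (Tuple (introT eqP (gn y))) => //.
  by rewrite mem_filter mem_enum andbT.
by move=> /mapP[v]; rewrite mem_filter => /andP[Qv _] ->.
Qed.

Section inclusion_exclusion.
Context (X : countType) (R : realType).
Let T := borel_type (Conf X).

(** Inclusion-exclusion: if al gives the probability that the sites of a list are
    all occupied, this is the probability that those of F are occupied and those
    of H are empty. *)
Fixpoint void_prob (al : seq nat -> R) (F H : seq nat) : R :=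
  if H is i :: H' then void_prob al F H' - void_prob al (i :: F) H' else al F.

(** The probability of a cylinder as a function of the correlation functions rho;
    a list containing a number that codes no site has probability 0 of being
    occupied. *)
Definition cylinder_prob (rho : seq X -> R) (v : seq bool) : R :=
  void_prob (fun F => if all (fun i => isSome (unpickle i : option X)) F
                      then rho (pmap unpickle F) else 0)
    [seq i <- iota 0 (size v) | nth false v i]
    [seq i <- iota 0 (size v) | ~~ nth false v i].

Lemma cvg_void_prob (al_ : nat -> seq nat -> R) al F H :
  (forall F, al_ ^~ F @ \oo --> al F) ->
  (fun n => void_prob (al_ n) F H) @ \oo --> void_prob al F H.
Proof.
by move=> cal; elim: H F => [|i H IHH] F /=; [exact: cal|exact: cvgB].
Qed.

Lemma cvg_cylinder_prob (rho_ : nat -> seq X -> R) rho v :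
  (forall F, rho_ ^~ F @ \oo --> rho F) ->
  (fun n => cylinder_prob (rho_ n) v) @ \oo --> cylinder_prob rho v.
Proof.
move=> crho; apply: cvg_void_prob => F; case: ifP => _; first exact: crho.
exact: cvg_cst.
Qed.

Definition occupied_void (F H : seq nat) : set (Conf X) :=
  [set w | all (fun i => occupied i w) F && all (fun i => ~~ occupied i w) H].

Lemma measurable_occupied i : measurable ([set w : Conf X | occupied i w] : set T).
Proof.
rewrite /occupied; case: unpickle => [x|]; last first.
  by rewrite (_ : mkset _ = set0)//; apply/seteqP; split.
by apply: measurable_open; exact: open_coordinate.
Qed.

Lemma measurable_occupied_void F H : measurable (occupied_void F H : set T).
Proof.
elim: F => [|i F IHF]; last first.
  rewrite (_ : occupied_void _ _ = [set w | occupied i w] `&` occupied_void F H).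
    by apply: measurableI => //; exact: measurable_occupied.
  by apply/seteqP; split=> w; rewrite /occupied_void/= -andbA => /andP.
elim: H => [|i H IHH].
  by rewrite (_ : occupied_void _ _ = setT)//; apply/seteqP; split.
rewrite (_ : occupied_void _ _ = ~` [set w | occupied i w] `&` occupied_void [::] H).
  by apply: measurableI => //; apply: measurableC; exact: measurable_occupied.
apply/seteqP; split=> w; rewrite /occupied_void/=; first by move=> /andP[/negP].
by move=> [/negP-> ->].
Qed.

Lemma prob_occupied_void (P : probability T R) F H :
  fine (P (occupied_void F H)) =
  void_prob (fun F => fine (P (occupied_void F [::]))) F H.
Proof.
elim: H F => [//|i H IHH] F /=; rewrite -!IHH; apply/eqP; rewrite eq_sym subr_eq -fineD.
- rewrite -measureU//; [|exact: measurable_occupied_void|exact: measurable_occupied_void|].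
    apply/eqP; congr (fine (P _)); apply/seteqP; split=> w; rewrite /occupied_void/=.
      by move=> /andP[-> ->]/=; rewrite andbT; case: (occupied i w); [right|left].
    by move=> [/and3P[-> _ ->]|/andP[/andP[_ ->] ->]].
  apply/seteqP; split => w //=; rewrite /occupied_void/= => -[/and3P[_ /negP oi _]].
  by move=> /andP[/andP[/oi]].
- by apply: fin_num_measure; exact: measurable_occupied_void.
- by apply: fin_num_measure; exact: measurable_occupied_void.
Qed.

Lemma prob_cylinder (P : probability T R) v :
  fine (P (cylinder v)) = cylinder_prob (fun F => fine (P (full_on F))) v.
Proof.
have -> : cylinder v = occupied_void [seq i <- iota 0 (size v) | nth false v i]
    [seq i <- iota 0 (size v) | ~~ nth false v i].
  apply/seteqP; split=> w; rewrite /cylinder/occupied_void/= !all_filter.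
    move=> wv; apply/andP; split; apply/allP => i; rewrite mem_iota => /andP[_ iv];
    by have E : occupied i w = nth false v i by [rewrite -[in RHS]wv /bits nth_mkseq]; rewrite /= E; case: nth.
  move=> /andP[/allP t /allP f]; apply: (@eq_from_nth _ false); first by rewrite size_mkseq.
  move=> i; rewrite size_mkseq => iv; rewrite nth_mkseq//.
  have := t i; have := f i; rewrite mem_iota/= iv.
  by case: (nth false v i) => /= [_ /(_ isT)->//|/(_ isT)/negPf->].
rewrite prob_occupied_void; congr void_prob; apply/funext => F.
case: ifP => [aF|/negbT/allPn[i iF iX]].
  congr (fine (P _)); apply/seteqP; split=> w; rewrite /occupied_void/full_on/= andbT.
    elim: F aF => //= i F IHF /andP[+ aF] /andP[+ oF]; rewrite /occupied.
    by case: unpickle => //= x _ ->/=; exact: IHF.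
  elim: F aF => //= i F IHF /andP[+ aF]; rewrite /occupied.
  by case: unpickle => //= x _ /andP[-> ?]/=; exact: IHF.
rewrite (_ : occupied_void _ _ = set0) ?measure0//; apply/seteqP; split=> w //=.
rewrite /occupied_void/= andbT => /allP/(_ _ iF); rewrite /occupied.
by move: iX; case: unpickle.
Qed.

End inclusion_exclusion.

(** * A random binary word from a uniform variable *)

Section nested_intervals.
Context (R : realType) (pv : seq bool -> R).
Hypothesis pv_ge0 : forall v, 0 <= pv v.
Hypothesis pv_nil : pv [::] = 1.
Hypothesis pv_split : forall v, pv v = pv (rcons v false) + pv (rcons v true).

(** The words of a given length index consecutive intervals of lengths pv v that
    tile [0, 1), in lexicographic order; this is the left end of the one indexed
    by v. *)
Definition left_end (v : seq bool) : R :=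
  \sum_(i < size v) if nth false v i then pv (rcons (take i v) false) else 0.

Lemma left_end_rcons v b : left_end (rcons v b) =
  left_end v + if b then pv (rcons v false) else 0.
Proof.
rewrite /left_end size_rcons big_ord_recr/= nth_rcons ltnn eqxx.
rewrite -cats1 take_size_cat//; congr (_ + _).
by apply: eq_bigr => i _; rewrite nth_cat ltn_ord takel_cat// ltnW.
Qed.

Definition next_bit (v : seq bool) (u : R) : bool :=
  left_end v + pv (rcons v false) <= u.

Fixpoint word (n : nat) (u : R) : seq bool :=
  if n is k.+1 then rcons (word k u) (next_bit (word k u) u) else [::].

Lemma size_word n u : size (word n u) = n.
Proof. by elim: n => //= n IHn; rewrite size_rcons IHn. Qed.

Lemma word_interval u v : 0 <= u < 1 ->
  (word (size v) u == v) = (left_end v <= u < left_end v + pv v).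
Proof.
move=> /andP[u0 u1]; elim/last_ind: v => [|v b IHv].
  by rewrite /left_end big_ord0 pv_nil add0r u0 u1.
rewrite size_rcons/= eqseq_rcons left_end_rcons.
rewrite (_ : _ && _ = (left_end v <= u < left_end v + pv v) && (next_bit v u == b)); last first.
  by rewrite -IHv; case: eqP => // ->.
rewrite /next_bit.
have s0 := pv_ge0 (rcons v false); have s1 := pv_ge0 (rcons v true).
have xE := pv_split v; rewrite {}xE {IHv}; case: b; rewrite ?addr0.
  rewrite eqb_id; apply/idP/idP => [/andP[/andP[? ?] ?]|/andP[? ?]].
    by apply/andP; split; lra.
  by apply/andP; split; [apply/andP; split|]; lra.
rewrite eqbF_neg -ltNge; apply/idP/idP => [/andP[/andP[? ?] ?]|/andP[? ?]].
  by apply/andP; split; lra.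
by apply/andP; split; [apply/andP; split|]; lra.
Qed.

Lemma measurable_word n v : measurable ((word n) @^-1` [set v] : set (measurableTypeR R)).
Proof.
elim: n v => [|n IHn] v.
  have [->|v0] := eqVneq v [::]; first by rewrite (_ : _ @^-1` _ = setT)//; apply/seteqP.
  rewrite (_ : _ @^-1` _ = set0)//; apply/seteqP; split=> u //= vE.
  by rewrite -vE eqxx in v0.
elim/last_ind: v => [|v b _].
  rewrite (_ : _ @^-1` _ = set0)//; apply/seteqP; split=> u //= E.
  by have := size_rcons (word n u) (next_bit (word n u) u); rewrite E.
rewrite (_ : _ @^-1` _ = word n @^-1` [set v] `&` [set u | next_bit v u = b]); last first.
  by apply/seteqP; split=> [u /= /rcons_inj[-> ->]|u /= [-> ->]].
apply: measurableI => //; rewrite /next_bit; set t := left_end v + _.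
case: b.
  rewrite (_ : mkset _ = `[t, +oo[%classic) //.
  by apply/seteqP; split=> u /=; rewrite in_itv/= andbT.
rewrite (_ : mkset _ = `]-oo, t[%classic) //.
by apply/seteqP; split=> u /=; rewrite in_itv/= ltNge; case: (t <= u).
Qed.

(** The half-open interval is the one tiled by the intervals of the words; the
    endpoint 1 has measure 0. *)
Lemma uniform_probE (E : set (measurableTypeR R)) : measurable E ->
  uniform_prob (@ltr01 R) E = lebesgue_measure (E `&` `[0, 1[%classic).
Proof.
move=> mE.
have -> : uniform_prob (@ltr01 R) E = (\int[uniform_prob (@ltr01 R)]_x (\1_E x)%:E)%E.
  by rewrite integral_indic// setIT.
rewrite integral_uniform//; last first.
  by apply/measurable_EFinP; exact: measurable_indic.
rewrite integral_indic// subr0 invr1 mul1e.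
have -> : E `&` `[0, 1]%classic = (E `&` `[0, 1[%classic) `|` (E `&` [set 1]) :> set R.
  apply/seteqP; split=> u /=; rewrite !in_itv/=.
    move=> [Eu /andP[u0]]; rewrite le_eqVlt => /predU1P[u1|u1]; first by right.
    by left; rewrite u0.
  move=> [[Eu /andP[u0 u1]]|[Eu u1]]; last by split => //; rewrite u1 ler01 lexx.
  by rewrite u0 ltW.
rewrite measureU//=; [|exact: measurableI|exact: measurableI|].
  rewrite [X in (_ + X)%E](_ : _ = 0%E) ?adde0//.
  apply/eqP; rewrite -measure_le0 -(lebesgue_measure_set1 (1 : R)) le_measure ?inE//.
  exact: measurableI.
apply/seteqP; split=> u //=; rewrite in_itv/= => -[[_ /andP[_ u1]] [_ u2]].
by rewrite u2 ltxx in u1.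
Qed.

Lemma uniform_word v :
  uniform_prob (@ltr01 R) (word (size v) @^-1` [set v]) = (pv v)%:E.
Proof.
rewrite uniform_probE; last exact: measurable_word.
have lv0 : 0 <= left_end v by apply: sumr_ge0 => i _; case: ifP.
have lv1 : left_end v + pv v <= 1.
  elim/last_ind: v {lv0} => [|v b IHv]; first by rewrite /left_end big_ord0 pv_nil add0r.
  rewrite left_end_rcons; have := pv_split v.
  have := pv_ge0 (rcons v false); have := pv_ge0 (rcons v true).
  by case: b => *; rewrite ?addr0; lra.
rewrite (_ : _ `&` _ = `[left_end v, left_end v + pv v[%classic); last first.
  apply/seteqP; split=> u /=; rewrite !in_itv/=.
    by move=> [wv u01]; rewrite -word_interval// wv.
  move=> /[dup] /andP[l1 l2] h.
  have u01 : 0 <= u < 1 by apply/andP; split; lra.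
  by split => //; apply/eqP; rewrite word_interval.
rewrite lebesgue_measure_itv/= lte_fin ltrDl lt_neqAle eq_sym pv_ge0 andbT.
case: eqVneq => [->//|_]/=.
by rewrite -EFinB addrAC subrr add0r.
Qed.

End nested_intervals.

(** * Existence of the limit process *)

Lemma cvgn_unique (R : realType) (u : nat -> R) (x y : R) :
  u @ \oo --> x -> u @ \oo --> y -> x = y.
Proof. by move=> ux uy; exact: (cvg_unique (@norm_hausdorff _ R) ux uy). Qed.

Lemma measurable_word_pred d (Y : measurableType d) (g : Y -> seq bool) (Q : pred (seq bool)) :
  (forall v, measurable (g @^-1` [set v])) -> measurable [set y | Q (g y)].
Proof.
move=> mg; rewrite (_ : mkset _ = \bigcup_(v in [set v | Q v]) (g @^-1` [set v])).
  rewrite bigcup_mkcond; apply: countable_bigcupT_measurable; first exact: countableP.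
  by move=> v; case: ifP.
by apply/seteqP; split=> [y Qy|y [v Qv]]; [exists (g y)|move=> /= ->].
Qed.

Lemma nth_word (R : realType) (pv : seq bool -> R) n i u : (i < n)%N ->
  nth false (word pv n u) i = nth false (word pv i.+1 u) i.
Proof.
elim: n => // n IHn; rewrite ltnS leq_eqVlt => /predU1P[->//|iN].
by rewrite [LHS]nth_rcons size_word iN IHn.
Qed.

Section limit_process.
Context (X : countType) (R : realType).
Let T := borel_type (Conf X).
Context (mu : nat -> probability T R) (rho : seq X -> R).
Hypothesis mu_rho : forall F, (fun N => fine (mu N (full_on F))) @ \oo --> rho F.

Let pv : seq bool -> R := cylinder_prob rho.

Lemma cvg_prob_cylinder v : (fun N => fine (mu N (cylinder v))) @ \oo --> pv v.
Proof.
rewrite (_ : (fun N => _) = fun N => cylinder_prob (fun F => fine (mu N (full_on F))) v).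
  exact: cvg_cylinder_prob.
by apply/funext => N; rewrite prob_cylinder.
Qed.

Let pv_ge0 v : 0 <= pv v.
Proof.
by apply: (cvgr_to_ge (@cvg_prob_cylinder v)); apply: nearW => N; exact: fine_ge0.
Qed.

Let pv_nil : pv [::] = 1.
Proof.
have := @cvg_prob_cylinder [::].
rewrite (_ : (fun N => _) = fun=> 1); first by move/cvgn_unique; apply; exact: cvg_cst.
apply/funext => N; rewrite (_ : cylinder [::] = setT) ?probability_setT//.
by apply/seteqP.
Qed.

Let pv_split v : pv v = pv (rcons v false) + pv (rcons v true).
Proof.
apply: (cvgn_unique (@cvg_prob_cylinder v)).
rewrite (_ : (fun N => _) = fun N => fine (mu N (cylinder (rcons v false))) +
   fine (mu N (cylinder (rcons v true)))).
  by apply: cvgD; exact: cvg_prob_cylinder.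
apply/funext => N.
have mc v' := @measurable_cylinder X v'.
rewrite -fineD ?fin_num_measure// -measureU//.
  congr (fine (mu N _)); apply/seteqP; split=> w; rewrite /cylinder/= !size_rcons !bitsS.
    by move=> ->; case: occupied; [right|left].
  by move=> [] /rcons_inj[-> _].
apply/seteqP; split=> w //=; rewrite /cylinder/= !size_rcons !bitsS.
by move=> [/rcons_inj[_ ->] /rcons_inj[]].
Qed.

Let sample (u : measurableTypeR R) : T :=
  fun x : X => nth false (word pv (pickle x).+1 u) (pickle x).

Let measurable_sample : measurable_fun setT sample.
Proof.
apply: measurable_fun_conf => x.
apply: (@measurable_word_pred _ (measurableTypeR R) (word pv (pickle x).+1)
  (fun v => nth false v (pickle x))).
exact: measurable_word.
Qed.

HB.instance Definition _ := isMeasurableFun.Build _ _ _ _ sample measurable_sample.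

(** The process is the law of the configuration whose bits are those of the
    nested intervals containing a uniform variable.  Only the correlation
    functions are computed: the sites of F are determined by a word of bounded
    length, whose law is the limit of the laws of the words of mu N. *)
Lemma limit_process_exists :
  exists P : probability T R, forall F, P (full_on F) = (rho F)%:E.
Proof.
exists (distribution (uniform_prob (@ltr01 R)) sample) => F.
(* enough bits to see all the sites of F *)
pose n := (\max_(x <- F) (pickle x).+1)%N.
pose Q (v : seq bool) := all (fun x : X => nth false v (pickle x)) F.
have nF x : x \in F -> (pickle x < n)%N.
  by move=> xF; rewrite /n (big_rem x)//= leq_maxl.
transitivity (uniform_prob (@ltr01 R) [set u : measurableTypeR R | Q (word pv n u)]).
  rewrite /= /distribution/pushforward/=; congr (uniform_prob _ _).
  apply/seteqP; split=> u /allP h; apply/allP => x xF.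
    by rewrite nth_word ?nF//; exact: h.
  by have := h x xF; rewrite nth_word ?nF.
rewrite (@measure_word_decomposition _ _ _ _ _ n)//; last 2 first.
- by move=> u; exact: size_word.
- by move=> v; exact: measurable_word.
transitivity (\sum_(v : n.-tuple bool | Q v) (pv v)%:E)%E.
  by apply: eq_bigr => v _; rewrite -(uniform_word pv_ge0 pv_nil pv_split v) size_tuple.
rewrite sumEFin; congr EFin.
apply/esym/(cvgn_unique (@mu_rho F)).
rewrite (_ : (fun N => _) = fun N => \sum_(v : n.-tuple bool | Q v) fine (mu N (cylinder v))).
  by apply: cvgr_sum => v _; exact: cvg_prob_cylinder.
apply/funext => N.
have cylE (v : n.-tuple bool) : cylinder v = bits n @^-1` [set tval v] :> set (Conf X).
  by rewrite /cylinder size_tuple.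
rewrite (_ : full_on F = [set w : Conf X | Q (bits n w)]); last first.
  apply/seteqP; split=> w /allP h; apply/allP => x xF.
    by rewrite nth_mkseq ?nF// occupied_pickle; exact: h.
  by have := h x xF; rewrite nth_mkseq ?nF// occupied_pickle.
rewrite (@measure_word_decomposition _ T _ (mu N) (bits n) n Q)//.
- rewrite -sum_fine//; last by move=> v _; rewrite -cylE fin_num_measure//; exact: measurable_cylinder.
  by apply: eq_bigr => v _; rewrite cylE.
- by move=> w; rewrite size_mkseq.
- move=> v; have [<-|vn] := eqVneq (size v) n; first exact: measurable_cylinder.
  rewrite (_ : _ @^-1` _ = set0)//; apply/seteqP; split=> w //= E.
  by move: vn; rewrite -E size_mkseq eqxx.
Qed.

End limit_process.

(** * Weak convergence from correlation functions *)

Section weak_convergence.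
Context (X : countType) (R : realType).
Let T := borel_type (Conf X).

Lemma sum_indic_cylinder n (phi : seq bool -> R) (w : Conf X) :
  phi (bits n w) = \sum_(v : n.-tuple bool) phi v * \1_(cylinder v) w.
Proof.
pose v0 : n.-tuple bool := Tuple (introT eqP (size_mkseq (fun i => occupied i w) n)).
rewrite (bigD1 v0)//= big1 ?addr0.
  rewrite indicE mem_set ?mulr1//; by rewrite /cylinder/= size_mkseq.
move=> v /eqP vv0; rewrite indicE memNset ?mulr0//.
by rewrite /cylinder/= size_tuple => E; apply: vv0; exact/val_inj.
Qed.

Lemma integral_bits (P : probability T R) n (phi : seq bool -> R) :
  P.-integrable setT (EFin \o (fun w : T => phi (bits n (w : Conf X)))) /\
  (\int[P]_w (phi (bits n (w : Conf X)))%:E =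
    (\sum_(v : n.-tuple bool) phi v * fine (P (cylinder v)))%:E)%E.
Proof.
pose h (v : n.-tuple bool) (w : T) := ((phi v)%:E * (\1_(cylinder v : set T) w)%:E)%E.
have hE : EFin \o (fun w : T => phi (bits n (w : Conf X))) = (fun w : T => \sum_v h v w)%E.
  by apply/funext => w; rewrite /= sum_indic_cylinder -sumEFin; apply: eq_bigr.
have mc v : measurable (cylinder v : set T) by exact: measurable_cylinder.
have ih v : P.-integrable setT (h v).
  by apply: integrableZl => //; exact: integrable_indic.
split; first by rewrite hE; exact: integrable_sum.
rewrite [LHS](_ : _ = \int[P]_w (\sum_v h v w))%E; last first.
  by apply: eq_integral => w _; rewrite -[RHS]/((fun w : T => \sum_v h v w)%E w) -hE.
rewrite integral_sum// -sumEFin; apply: eq_bigr => v _.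
rewrite integralZl//; last exact: integrable_indic.
by rewrite integral_indic// setIT EFinM fineK// fin_num_measure.
Qed.

(** A continuous function is replaced, up to e / 3 uniformly in the measure, by a
    function of the first n bits, whose integral is a finite combination of
    cylinder probabilities. *)
Theorem weakly_converges_full_on (mu : nat -> probability T R) (P : probability T R) :
  (forall F, (fun N => fine (mu N (full_on F))) @ \oo --> fine (P (full_on F))) ->
  weakly_converges mu P.
Proof.
move=> muP f cf bf.
have finT (Q : probability T R) : (Q [set: T] < +oo)%E.
  by apply: (@le_lt_trans _ _ 1%E); [exact: probability_le1|exact: ltry].
have intf (Q : probability T R) : Q.-integrable setT (EFin \o (f : T -> R)).
  apply: measurable_bounded_integrable => //; first exact: finT.
  exact: measurable_fun_continuous.
pose I (Q : probability T R) := fine (\int[Q]_(w in setT) (f w)%:E)%E.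
have IE (Q : probability T R) : (\int[Q]_(w in setT) (f w)%:E = (I Q)%:E)%E.
  by rewrite fineK//; exact: (integrable_fin_num _ (intf Q)).
rewrite IE (_ : (fun n => _) = EFin \o (fun N => I (mu N))); last first.
  by apply/funext => N; rewrite IE.
apply: cvg_EFin; first exact: nearW.
apply/cvgrPdist_le => e e0.
have e3 : 0 < e / 3 by rewrite divr_gt0.
have [n nP] := uniform_bits cf e3.
pose phi v := f (get (cylinder v)).
have fphi w : `|f w - phi (bits n w)| < e / 3.
  have wc : cylinder (bits n w) w by rewrite /cylinder/= size_mkseq.
  apply: nP; have := getI wc.
  by rewrite /cylinder/= size_mkseq => ->.
pose S (Q : probability T R) := \sum_(v : n.-tuple bool) phi v * fine (Q (cylinder v)).
have IS (Q : probability T R) : `|I Q - S Q| <= e / 3.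
  have [iphi ephi] := integral_bits Q n phi.
  rewrite (_ : S Q = fine (\int[Q]_w (phi (bits n (w : Conf X)))%:E)%E); last by rewrite ephi.
  rewrite -[I Q]/(\int[Q]_(w in setT) f w) -[fine _]/(\int[Q]_(w in setT) phi (bits n w)).
  rewrite -(RintegralB measurableT (intf Q) iphi).
  apply: (le_trans (le_normr_Rintegral _ _)) => //.
    by have := integrableB measurableT (intf Q) iphi.
  have -> : e / 3 = \int[Q]_(w in [set: T]) (e / 3).
    by rewrite Rintegral_cst// [X in fine X](_ : _ = 1%E) ?mulr1//; exact: probability_setT.
  apply: le_Rintegral => //.
  - have := integrable_norm (integrableB measurableT (intf Q) iphi).
    by [].
  - apply: measurable_bounded_integrable => //; first exact: finT.
    exact: bounded_cst.
  - by move=> w _; exact/ltW.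
have cS : (fun N => S (mu N)) @ \oo --> S P.
  apply: cvgr_sum => v _; apply: cvgMl_tmp; rewrite prob_cylinder.
  rewrite (_ : (fun N => _) = fun N => cylinder_prob (fun F => fine (mu N (full_on F))) v).
    exact: cvg_cylinder_prob.
  by apply/funext => N; rewrite prob_cylinder.
have /cvgrPdist_le/(_ _ e3) cS3 := cS.
near=> N.
have h1 : `|S P - S (mu N)| <= e / 3 by near: N.
have h2 := IS P; have h3 := IS (mu N).
rewrite /= in h1 h2 h3 *; move: (I P) (I (mu N)) (S P) (S (mu N)) h1 h2 h3 => x y u v.
move=> /ler_normlP[? ?] /ler_normlP[? ?] /ler_normlP[? ?].
by apply/ler_normlP; split; lra.
Unshelve. all: by end_near. Qed.

End weak_convergence.

(** * The limit theorem *)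

Lemma full_on_ord (X : countType) n (y : 'I_n -> X) :
  [set w : Conf X | forall i, w (y i)] = full_on [seq y i | i <- enum 'I_n].
Proof.
apply/seteqP; split=> w; rewrite /full_on/= all_map.
  by move=> wy; apply/allP => i _; exact: wy.
by move=> /allP wy i; apply: wy; rewrite mem_enum.
Qed.

(** Removing repetitions turns a list of sites into an injective family, as in
    the definition of correlation functions. *)
Lemma full_on_nth (F : seq int) :
  full_on F = [set w : Conf int | forall i : 'I_(size (undup F)), w (nth 0 (undup F) i)].
Proof.
apply/seteqP; split=> w; rewrite /full_on/=.
  by move=> /allP wF i; apply: wF; rewrite -mem_undup mem_nth.
move=> wF; apply/allP => x; rewrite -mem_undup => xF.
have := wF (Ordinal (etrans (index_mem _ _) xF)).
by rewrite /= nth_index.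
Qed.

Lemma nth_undup_inj (F : seq int) :
  injective (fun i : 'I_(size (undup F)) => nth 0 (undup F) i).
Proof.
by move=> i j /eqP; rewrite nth_uniq ?undup_uniq// => /eqP/val_inj.
Qed.

Lemma sine_kernel_shift (R : realType) (phi : R) (k x y : int) :
  sine_kernel phi (x - k) (y - k) = sine_kernel phi x y.
Proof.
by rewrite /sine_kernel (inj_eq (addIr (- k))) opprB addrA subrK.
Qed.

Section correlations.
Context (R : realType) (p c : R) (hp : 0 < p < 1).
Hypothesis hc : `|c| < 2 * Num.sqrt (p * (1 - p)).
Context (a : nat -> int).
Hypothesis ha : (fun N : nat => (a N)%:~R / N%:R : R) @ \oo --> c.
Let phi := acos (c * (1 - 2 * p) / (2 * Num.sqrt (p * (1 - p) * (1 - c ^+ 2)))).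

Lemma shifted_krawtchouk_correlation N n (y : 'I_n -> int) : (0 < N)%N ->
  (forall i, (site a N (y i) < krawtchouk_L N)%N) ->
  (forall i, (site a N (y i))%:Z = N%:Z + a N + y i) ->
  injective y ->
  fine (shifted_krawtchouk hp N (a N) [set w : Conf int | forall i, w (y i)]) =
  \det (\matrix_(i, j) kraw_kernel p N (site a N (y i)) (site a N (y j))).
Proof.
move=> N0 sL sE yi.
pose s i : 'I_(krawtchouk_L N).+1 := Ordinal (ltnW (sL i) : (site a N (y i) < (krawtchouk_L N).+1)%N).
have si : injective s.
  move=> i j /(congr1 val)/= /(congr1 Posz); rewrite !sE => /addrI; exact: yi.
have := krawtchouk_correlation hp N0 si => /= <-.
rewrite /shifted_krawtchouk [RHS]big_mkcond/=.
rewrite (eq_bigr (fun A : {set 'I_(krawtchouk_L N).+1} =>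
  (if [forall i, s i \in A] then krawtchouk_prob p A else 0)%:E)).
  by rewrite sumEFin.
move=> A _; rewrite diracE.
have -> : (shifted_conf (a N) A \in ([set w : Conf int | forall i, w (y i)] : set (borel_type (Conf int))))
    = [forall i, s i \in A].
  apply/idP/forallP => [|sA].
    rewrite inE /= => h i; have := h i; rewrite /shifted_conf => /exists_inP[j jA /eqP yj].
    suff -> : s i = j by [].
    by apply/val_inj => /=; apply/eqP; rewrite -eqz_nat sE yj; apply/eqP; ring.
  rewrite inE /= => i; apply/exists_inP; exists (s i) => //.
  by rewrite /= sE; apply/eqP; ring.
by case: ifP => _; rewrite ?mule1 ?mule0.
Qed.

Lemma correlation_cvg n (y : 'I_n -> int) : injective y ->
  (fun N => fine (shifted_krawtchouk hp N (a N) [set w : Conf int | forall i, w (y i)])) @ \oo -->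
  \det (\matrix_(i, j) sine_kernel phi (y i) (y j)).
Proof.
move=> yi.
have H : (fun N => \det (\matrix_(i, j) kraw_kernel p N (site a N (y i)) (site a N (y j)))) @ \oo -->
    \det (\matrix_(i, j) sine_kernel phi (y i) (y j)).
  apply: cvg_det => i j; rewrite mxE; under eq_fun do rewrite mxE.
  exact: (kernel_cvg hp hc ha).
apply: cvg_trans H; apply: near_eq_cvg; near=> N.
have N0 : (0 < N)%N by near: N; exact: nbhs_infty_gt.
have sy (i : 'I_n) : interior_site a N (y i).
  move: i; near: N; apply: filter_forall => i.
  exact: (near_interior_site (c_lt1 hp hc) ha).
by rewrite shifted_krawtchouk_correlation// => i; have [] := sy i.
Unshelve. all: by end_near. Qed.

End correlations.

(** The shifted process has the same correlation functions, hence the same law. *)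
Lemma determinantal_translation_invariant (R : realType) (P : point_process int R) (phi : R) :
  determinantal P (sine_kernel phi) -> translation_invariant P.
Proof.
move=> detP k.
have msh : measurable_fun setT (shift_conf k : borel_type (Conf int) -> borel_type (Conf int)).
  apply: measurable_fun_conf => x; rewrite /shift_conf.
  rewrite (_ : mkset _ = full_on [:: x - k]); first exact: measurable_full_on.
  by apply/seteqP; split=> w; rewrite /full_on/= andbT.
pose sh : {mfun borel_type (Conf int) >-> borel_type (Conf int)} :=
  HB.pack (shift_conf k : borel_type (Conf int) -> borel_type (Conf int))
    (isMeasurableFun.Build _ _ _ _ _ msh).
move=> B mB; apply/esym.
rewrite -[RHS]/(distribution P sh B).
apply: point_process_unique => // [|F].
  by apply: (@le_lt_trans _ _ 1%E); [exact: probability_le1|exact: ltry].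
rewrite -[RHS]/(P (shift_conf k @^-1` full_on F)) full_on_nth.
have [F0|F0] := posnP (size (undup F)).
  congr (P _); apply/seteqP; split=> w h /= i; exfalso; have := ltn_ord i; by rewrite {2}F0.
pose y (i : 'I_(size (undup F))) : int := nth 0 (undup F) i.
have yi : injective y by exact: nth_undup_inj.
have yki : injective (fun i => y i - k) by move=> i j /addIr/yi.
apply: (etrans (detP _ y F0 yi)); apply/esym/(etrans (detP _ _ F0 yki)).
by congr (\det _)%:E; apply/matrixP => i j; rewrite !mxE sine_kernel_shift.
Qed.

Theorem proposition5p2 (R : realType) (p : R) (hp : 0 < p < 1) (c : R)
    (hc : `|c| < 2 * Num.sqrt (p * (1 - p))) (a : nat -> int)
    (ha : (fun N : nat => (a N)%:~R / N%:R : R) @ \oo --> c) :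
  let phi : R :=
    acos (c * (1 - 2 * p) / (2 * Num.sqrt ((1 - c ^+ 2) * p * (1 - p)))) in
  exists P : point_process int R,
    [/\ translation_invariant P,
        determinantal P (sine_kernel phi) &
        weakly_converges (fun N : nat => shifted_krawtchouk hp N (a N)) P].
Proof.
move=> phi.
have phiE : phi = acos (c * (1 - 2 * p) / (2 * Num.sqrt (p * (1 - p) * (1 - c ^+ 2)))).
  by rewrite /phi; congr (acos (_ / (_ * Num.sqrt _))); ring.
have corr n (y : 'I_n -> int) := @correlation_cvg R p c hp hc a ha n y.
pose rho (F : seq int) := \det (\matrix_(i < size (undup F), j < size (undup F))
  sine_kernel phi (nth 0 (undup F) i) (nth 0 (undup F) j)).
have mu_rho F : (fun N => fine (shifted_krawtchouk hp N (a N) (full_on F))) @ \oo --> rho F.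
  by rewrite full_on_nth /rho phiE; apply: corr; exact: nth_undup_inj.
have [P Prho] := @limit_process_exists _ R (fun N => shifted_krawtchouk hp N (a N)) rho mu_rho.
have detP : determinantal P (sine_kernel phi).
  move=> n y n0 yi; rewrite full_on_ord Prho; congr EFin.
  apply: (cvgn_unique (@mu_rho _)); rewrite -full_on_ord phiE; exact: corr.
exists P; split => //; first exact: determinantal_translation_invariant detP.
apply: weakly_converges_full_on => F; rewrite Prho; exact: mu_rho.
Qed.
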